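(* Let $G$ be a mean-payoff game, $\lambda$ a requirement, $i\in\Pi$, $v_0\in V_i$ and $\beta\in\mathbb{N}$. In the reduced negotiation game $\mathsf{Red}^\beta_{\lambda i}(G)$ from $v_0$, Prover has an optimal strategy that is memoryless.
   Context: Mean-payoff game $G$: finite player set $\Pi$, finite directed graph $(V,E)$ with every vertex having an outgoing edge, partition $(V_i)_i$, rewards $r_i:E\to\mathbb{Q}$, payoff $\mu_i(\rho)=\liminf_n\frac1n\sum_{k<n}r_i(\rho_k\rho_{k+1})$. $\mathsf{Occ}(\rho)$ is the set of vertices occurring in $\rho$; $|h|$ is the number of vertices of a history $h$. A requirement is $\lambda:V\to\mathbb{R}\cup\{\pm\infty\}$; a play $\rho$ is $\lambda$-consistent if $\mu_j(\rho_{\ge n})\ge\lambda(\rho_n)$ for all $n$, $j$ with $\rho_n\in V_j$. Size of rationals: $\lVert p/q\rVert=1+\lceil\log_2(|p|+1)\rceil+\lceil\log_2(|q|+1)\rceil$ (coprime), size of tuples = number of entries + sum of entry sizes. Punishment family: for a simple history $h$, a nonempty simple cycle $c$, $W\subseteq V$, $\bar x\in\mathbb{R}^\Pi$, the set $hc^\infty\rho=\{hc^n\rho' : n>0,\ hc^n\rho'\text{ is a play},\ \mu(\rho')=\bar x,\ \mathsf{Occ}(\rho')=W\}$ (nonempty), for any play $\rho$ with $\mu(\rho)=\bar x$, $\mathsf{Occ}(\rho)=W$; $c$ is its punishing cycle; it is a $\beta$-punishment family if $\lVert\bar x\rVert\le\beta$; it is $\lambda$-consistent if its elements are; all its elements have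 payoff vector $\bar x$. Reduced negotiation game $\mathsf{Red}^\beta_{\lambda i}(G)$: two players, Prover and Challenger. Prover's states are the vertices of $V$. Challenger's states are: $[hc^\infty\rho]$ for each $\lambda$-consistent $\beta$-punishment family; $(c,u)$ where $c$ is the punishing cycle of such a family $hc^\infty\rho$ and some vertex of $\rho$ in $V_i$ has an edge to $u$; $[h'w]$ where $h'$ is a prefix of $hc$ for such a family, $\mathsf{last}(h')\in V_i$ and $\mathsf{last}(h')w\in E$; and two states $\top,\bot$. Transitions: $v\to[hc^\infty\rho]$ (Prover proposes a family whose plays start at $v$), $v\to\bot$ (Prover gives up), $[hc^\infty\rho]\to\top$ (Challenger accepts), $[hc^\infty\rho]\to[h'w]$ (pre-cycle deviation, $h'$ prefix of $hc$), $[hc^\infty\rho]\to(c,u)$ (post-cycle deviation), $[h'w]\to w$, $(c,u)\to u$, $\top\to\top$, $\bot\to\bot$. For a history or play $H=H_0H_1\dots$ not reaching $\bot$, define $\dot H=h^{(1)}h^{(2)}\dots$ in $G$ by: if $H_{k-1}H_k=v[hc^\infty\rho]$, or $[h'w]w$, or $(c,w)w$, then $h^{(k)}$ is empty; if $H_{k-1}H_k=[hc^\infty\rho]\top$, then $h^{(k)}h^{(k+1)}\dots=hc^{N^2}\rho$ with $N=|h^{(1)}\dots h^{(k-1)}h|$; if $H_{k-1}H_k=[hc^\infty\rho][h'w]$, then $h^{(k)}=h'$; if $H_{k-1}H_k=[hc^\infty\rho](c,w)$, then $h^{(k)}=hc^{N^2}h'$ with $N$ as before and $h'$ a shortest history with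 $\mathsf{Occ}(h')\subseteq\mathsf{Occ}(\rho)$, $\mathsf{last}(h')\in V_i$, $\mathsf{last}(h')w\in E$. Payoffs: $\nu_\mathbb{C}(\pi)=-\nu_\mathbb{P}(\pi)=+\infty$ if $\pi$ reaches $\bot$, and $\mu_i(\dot\pi)$ otherwise. A strategy is memoryless if its choice depends only on the current state; it is optimal for Prover if it attains $\inf_{\tau_\mathbb{P}}\sup_{\tau_\mathbb{C}}\nu_\mathbb{C}$. *)

(* Defs.v *)
From HB Require Import structures.
From mathcomp Require Import all_boot all_order all_algebra.
From mathcomp Require Import boolp classical_sets reals ereal sequences.
From Stdlib Require Import ClassicalEpsilon.

Set Implicit Arguments.
Unset Strict Implicit.
Unset Printing Implicit Defensive.

Import Order.TTheory GRing.Theory Num.Theory.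
Local Open Scope ring_scope.

(* up_log 2 m is the least e with m <= 2^e, i.e. ceil(log2 m), m >= 1. *)
Definition rat_size (q : rat) : nat :=
  (1 + up_log 2 (`|numq q|%N + 1) + up_log 2 (`|denq q|%N + 1))%N.

Definition vec_size (P : finType) (x : P -> rat) : nat :=
  (#|P| + \sum_(j : P) rat_size (x j))%N.

Fixpoint ncat {T : Type} (n : nat) (c : seq T) : seq T :=
  if n is n'.+1 then c ++ ncat n' c else [::].

Definition catstream {T : Type} (s : seq T) (rho : nat -> T) : nat -> T :=
  fun n => if (n < size s)%N then nth (rho 0%N) s n else rho (n - size s)%N.

Section MeanPayoff.
Variable R : realType.
Variables (Pl V : finType) (E : rel V) (owner : V -> Pl)
          (r : Pl -> V -> V -> rat).

Local Open Scope ereal_scope.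

Definition isPlay (rho : nat -> V) : Prop := forall n, E (rho n) (rho n.+1).

Definition isHist (h : seq V) : Prop :=
  if h is x :: h' then path E x h' else False.

Definition mp (j : Pl) (rho : nat -> V) : \bar R :=
  limn_einf (fun n : nat =>
    ((n.+1%:R)^-1 * \sum_(k < n.+1) ratr (r j (rho k) (rho k.+1)) : R)%:E).

Definition suffix_from (rho : nat -> V) (n : nat) : nat -> V :=
  fun k => rho (n + k)%N.

Definition consistent (lam : V -> \bar R) (rho : nat -> V) : Prop :=
  forall n, lam (rho n) <= mp (owner (rho n)) (suffix_from rho n).

Definition occ_is (rho : nat -> V) (W : {set V}) : Prop :=
  forall v, v \in W <-> exists n, rho n = v.

(* A pun_family is given by its data (h, c, W, x) where W = Occ(rho) and   *)
(* x = mu(rho) for the representative play rho.                        *)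
Record pun_family := PunFamily {
  fh : seq V;
  fc : seq V;
  fW : {set V};
  fx : {ffun Pl -> rat}
}.

Definition has_payoff (rho : nat -> V) (x : Pl -> rat) : Prop :=
  forall j, mp j rho = (ratr (x j) : R)%:E.

Definition in_family (f : pun_family) (pi : nat -> V) : Prop :=
  exists n, (0 < n)%N /\ exists rho' : nat -> V,
    pi = catstream (fh f ++ ncat n (fc f)) rho' /\ isPlay pi /\
    has_payoff rho' (fx f) /\ occ_is rho' (fW f).

Definition simple_hist (h : seq V) : Prop := isHist h /\ uniq h.
Definition simple_cycle (c : seq V) : Prop :=
  c <> [::] /\ uniq c /\ cycle E c.

Definition valid_family (lam : V -> \bar R) (beta : nat) (f : pun_family) : Prop :=
  [/\ simple_hist (fh f), simple_cycle (fc f),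
      (exists pi, in_family f pi),
      (forall pi, in_family f pi -> consistent lam pi) &
      (vec_size (fx f) <= beta)%N].

Definition rep (v0 : V) (f : pun_family) : nat -> V :=
  epsilon (inhabits (fun _ => v0))
          (fun rho => isPlay rho /\ has_payoff rho (fx f) /\ occ_is rho (fW f)).

Inductive rstate :=
| SProver of V
| SFam of pun_family
| SPost of seq V & V
| SPre of seq V & V
| STop
| SBot.

Definition isProver (s : rstate) : bool := if s is SProver _ then true else false.

Definition rtrans (lam : V -> \bar R) (i : Pl) (beta : nat)
  (s s' : rstate) : Prop :=
  match s, s' with
  | SProver v, SFam f => valid_family lam beta f /\ head v (fh f) = v
                         /\ fh f <> [::]
  | SProver _, SBot => True
  | SFam _, STop => True
  | SFam f, SPre h' w =>
      [/\ h' <> [::], prefix h' (fh f ++ fc f),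
          owner (last w h') = i & E (last w h') w]
  | SFam f, SPost c u =>
      c = fc f /\ exists x, [/\ x \in fW f, owner x = i & E x u]
  | SPre _ w, SProver w' => w' = w
  | SPost _ u, SProver u' => u' = u
  | STop, STop => True
  | SBot, SBot => True
  | _, _ => False
  end.

Fixpoint tpath (lam : V -> \bar R) (i : Pl) (beta : nat)
  (x : rstate) (s : seq rstate) : Prop :=
  if s is y :: s' then rtrans lam i beta x y /\ tpath lam i beta y s' else True.

(* Histories from v0 are represented as SProver v0 :: t, with t : seq rstate.
   A strategy maps (the tail t of) a history to the next state. *)
Definition strategy := seq rstate -> rstate.

Definition valid_strategy (lam : V -> \bar R) (i : Pl) (beta : nat) (v0 : V)
  (prover : bool) (sg : strategy) : Prop :=
  forall t, tpath lam i beta (SProver v0) t ->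
    isProver (last (SProver v0) t) = prover ->
    rtrans lam i beta (last (SProver v0) t) (sg t).

Definition memoryless (lam : V -> \bar R) (i : Pl) (beta : nat) (v0 : V)
  (sg : strategy) : Prop :=
  forall t t', tpath lam i beta (SProver v0) t -> tpath lam i beta (SProver v0) t' ->
    isProver (last (SProver v0) t) ->
    last (SProver v0) t = last (SProver v0) t' -> sg t = sg t'.

Fixpoint out_tail (v0 : V) (sP sC : strategy) (k : nat) : seq rstate :=
  if k is k'.+1 then
    let t := out_tail v0 sP sC k' in
    rcons t (if isProver (last (SProver v0) t) then sP t else sC t)
  else [::].

Definition outcome (v0 : V) (sP sC : strategy) : nat -> rstate :=
  fun k => last (SProver v0) (out_tail v0 sP sC k).

(* sel f w : the chosen shortest history h' for a post-cycle deviation *)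
Definition piece (sel : pun_family -> V -> seq V) (acc : seq V)
  (s s' : rstate) : seq V :=
  match s, s' with
  | SFam f, SPre h' _ => h'
  | SFam f, SPost _ w =>
      let N := size (acc ++ fh f) in fh f ++ ncat (N ^ 2) (fc f) ++ sel f w
  | SFam f, STop =>
      let N := size (acc ++ fh f) in fh f ++ ncat (N ^ 2) (fc f)
  | _, _ => [::]
  end.

Fixpoint acc (sel : pun_family -> V -> seq V) (pi : nat -> rstate) (k : nat)
  : seq V :=
  if k is k'.+1 then
    let a := acc sel pi k' in a ++ piece sel a (pi k') (pi k)
  else [::].

Definition is_dot (v0 : V) (sel : pun_family -> V -> seq V) (pi : nat -> rstate)
  (rho : nat -> V) : Prop :=
  (forall k f, pi k = SFam f -> pi k.+1 = STop ->
     rho = catstream (acc sel pi k.+1) (rep v0 f)) /\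
  ((forall k, pi k <> STop) ->
     forall k n, (n < size (acc sel pi k))%N -> rho n = nth v0 (acc sel pi k) n).

Definition dot (v0 : V) (sel : pun_family -> V -> seq V) (pi : nat -> rstate)
  : nat -> V :=
  epsilon (inhabits (fun _ => v0)) (is_dot v0 sel pi).

Definition nuC (i : Pl) (v0 : V) (sel : pun_family -> V -> seq V)
  (pi : nat -> rstate) : \bar R :=
  if `[< exists k, pi k = SBot >] then +oo else mp i (dot v0 sel pi).

(* Specification of a "shortest history" choice for post-cycle deviations:
   h' with Occ(h') in Occ(rho), last(h') in V_i, last(h') w in E, and such
   that h c^N h' is a history (first(h') is a successor of last(c)). *)
Definition dev_hist (i : Pl) (f : pun_family) (w : V) (h' : seq V) : Prop :=
  [/\ isHist h', {subset h' <= fW f}, owner (last w h') = i,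
      E (last w h') w & E (last w (fc f)) (head w h')].

Definition shortest_sel (i : Pl) (sel : pun_family -> V -> seq V) : Prop :=
  forall f w, (exists h', dev_hist i f w h') ->
    dev_hist i f w (sel f w) /\
    forall h', dev_hist i f w h' -> (size (sel f w) <= size h')%N.

Definition prover_value (lam : V -> \bar R) (i : Pl) (beta : nat) (v0 : V)
  (sel : pun_family -> V -> seq V) (sP : strategy) : \bar R :=
  ereal_sup [set nuC i v0 sel (outcome v0 sP sC) |
             sC in [set sC | valid_strategy lam i beta v0 false sC]].

Definition optimal_prover (lam : V -> \bar R) (i : Pl) (beta : nat) (v0 : V)
  (sel : pun_family -> V -> seq V) (sP : strategy) : Prop :=
  prover_value lam i beta v0 sel sP =
  ereal_inf [set prover_value lam i beta v0 sel sP' |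
             sP' in [set sP' | valid_strategy lam i beta v0 true sP']].

End MeanPayoff.

(* Main.v *)
Require Import Defs.
From HB Require Import structures.
From mathcomp Require Import all_boot all_order all_algebra.
From mathcomp Require Import boolp classical_sets reals ereal sequences.
From mathcomp Require Import lra ring zify.
From Stdlib Require Import ClassicalEpsilon.

(* Only finitely many punishment families are valid, so there are finitely many
   memoryless strategies, and one of them has least value.  It is optimal because,
   for every real threshold [alpha], either Challenger secures at least [alpha]
   against every strategy or some memoryless strategy secures at most [alpha].

   For this dichotomy, give a pre-cycle deviation the sum of the rewards minus
   [alpha] along its history.  The [N ^ 2] copies of the punishing cycle outweigh
   the whole past, so a post-cycle deviation gets a huge positive weight if the
   mean of its cycle is at least [alpha], and an even larger negative one
   otherwise.  In the resulting finite energy game one of the players owns a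
   potential function; it telescopes along a play, up to an error of the order of
   the number of post-cycle deviations, which is at most the square root of the
   length of the play. *)

Set Implicit Arguments.
Unset Strict Implicit.
Unset Printing Implicit Defensive.

Import Order.TTheory GRing.Theory Num.Theory.
Local Open Scope ring_scope.

(** * Memoryless certificates in finite energy games *)

Section EnergyGames.
Variables (R : realDomainType) (T : finType).
Implicit Types (z : T -> T -> R) (own : pred T) (e : rel T).
Implicit Types (U : {set T}) (Phi : T -> R) (u v w x : T).

(* [Phi] is an energy level from which the owner of the states in [own] keeps
   the running sum of the weights [z] bounded from below while staying in [U];
   negating [z] and [own] gives the certificates of the opponent. *)
Definition energy_cert z own e U Phi :=
  forall v, v \in U ->
    if own v then exists2 w, e v w & w \in U /\ Phi w <= Phi v + z v w
    else forall w, e v w -> w \in U /\ Phi w <= Phi v + z v w.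

Definition energy_win z own e x :=
  exists2 U : {set T}, x \in U & exists Phi, energy_cert z own e U Phi.

(** The owner may ignore additional edges at its own state [u]. *)
Lemma energy_win_own z own e e' u x : own u ->
  (forall v w, v != u -> e v w = e' v w) -> (forall w, e' u w -> e u w) ->
  energy_win z own e' x -> energy_win z own e x.
Proof.
move=> ou ee' e'u [U xU [Phi cert]]; exists U => //; exists Phi => v vU.
have := cert v vU; case: (eqVneq v u) => [->|vu].
  by rewrite ou => -[w /e'u ew ?]; exists w.
case: (own v) => [[w ew ?]|H w ew]; first by exists w => //; rewrite ee'.
by apply: H; rewrite -ee'.
Qed.

(** A certificate whose region avoids [u] never consults the edges out of [u]. *)
Lemma energy_win_outside z own e e' u x U Phi :
  (forall v w, v != u -> e v w = e' v w) -> u \notin U -> x \in U ->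
  energy_cert z own e' U Phi -> energy_win z own e x.
Proof.
move=> ee' uU xU cert; exists U => //; exists Phi => v vU.
have vu : v != u by apply: contraNneq uU => <-.
have := cert v vU.
case: (own v) => [[w ew ?]|H w ew]; first by exists w => //; rewrite ee'.
by apply: H; rewrite -ee'.
Qed.

(* After normalising both potentials at [u], their pointwise minimum is again a
   potential: this is what makes the opponent's choice at [u] memoryless. *)
Lemma energy_win_opp z own e e1 e2 u x : ~~ own u ->
  (forall v w, v != u -> e v w = e1 v w) ->
  (forall v w, v != u -> e v w = e2 v w) ->
  (forall w, e u w -> e1 u w || e2 u w) ->
  energy_win z own e1 x -> energy_win z own e2 x -> energy_win z own e x.
Proof.
move=> ou ee1 ee2 eu [U1 xU1 [P1 c1]] [U2 xU2 [P2 c2]].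
have [uU1|uU1] := boolP (u \in U1); last exact: energy_win_outside ee1 uU1 xU1 c1.
have [uU2|uU2] := boolP (u \in U2); last exact: energy_win_outside ee2 uU2 xU2 c2.
pose Q1 v := P1 v - P1 u; pose Q2 v := P2 v - P2 u.
pose P v := if v \in U1 then if v \in U2 then Num.min (Q1 v) (Q2 v) else Q1 v
            else Q2 v.
have PQ1 v : v \in U1 -> P v <= Q1 v.
  by rewrite /P => ->; case: ifP; rewrite // ge_min lexx.
have PQ2 v : v \in U2 -> P v <= Q2 v.
  by rewrite /P => ->; case: ifP; rewrite // ge_min lexx orbT.
have Pu : P u = 0 by rewrite /P uU1 uU2 /Q1 /Q2 !subrr minxx.
have PE v : v \in (U1 :|: U2) ->
    (v \in U1 /\ P v = Q1 v) \/ (v \in U2 /\ P v = Q2 v).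
  rewrite inE /= /P; case: (boolP (v \in U1)) => vU1 /=; last by right.
  case: ifP => vU2 _; last by left.
  by case: (leP (Q1 v) (Q2 v)); [left|right].
exists (U1 :|: U2); first by rewrite inE /= xU1.
exists P => v vU.
have [->|vu] := eqVneq v u.
  rewrite (negbTE ou) => w /eu /orP[ew|ew].
    have := c1 u uU1; rewrite (negbTE ou) => /(_ w ew)[wU le]; split.
      by rewrite inE /= wU.
    by apply: le_trans (PQ1 _ wU) _; rewrite Pu /Q1; lra.
  have := c2 u uU2; rewrite (negbTE ou) => /(_ w ew)[wU le]; split.
    by rewrite inE /= wU orbT.
  by apply: le_trans (PQ2 _ wU) _; rewrite Pu /Q2; lra.
case: (PE v vU) => -[vUj ->].
  have := c1 v vUj; case: (own v) => [[w ew [wU le]]|H w ew].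
    exists w; first by rewrite ee1.
    split; first by rewrite inE /= wU.
    by apply: le_trans (PQ1 _ wU) _; rewrite /Q1; lra.
  have [|wU le] := H w; first by rewrite -ee1.
  split; first by rewrite inE /= wU.
  by apply: le_trans (PQ1 _ wU) _; rewrite /Q1; lra.
have := c2 v vUj; case: (own v) => [[w ew [wU le]]|H w ew].
  exists w; first by rewrite ee2.
  split; first by rewrite inE /= wU orbT.
  by apply: le_trans (PQ2 _ wU) _; rewrite /Q2; lra.
have [|wU le] := H w; first by rewrite -ee2.
split; first by rewrite inE /= wU orbT.
by apply: le_trans (PQ2 _ wU) _; rewrite /Q2; lra.
Qed.

Definition opp_weight z v w := - z v w.

(** With one successor per state, the play from [x] is a lasso. Its running sums form a potential
    with equality on every edge but the one closing the cycle; there the sign of the cycle sum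
    decides which player is served. *)
Lemma energy_dichotomy_fun z own e (g : T -> T) x :
  (forall v w, e v w = (w == g v)) ->
  energy_win z own e x \/ energy_win (opp_weight z) (predC own) e x.
Proof.
move=> eg.
pose S k := \sum_(j < k) z (iter j g x) (iter j.+1 g x).
have SS k : S k.+1 = S k + z (iter k g x) (iter k.+1 g x).
  by rewrite /S big_ord_recr.
pose U := [set v in orbit g x].
have cert z' own' Phi :
    (forall v, v \in U -> g v \in U -> Phi (g v) <= Phi v + z' v (g v)) ->
    energy_win z' own' e x.
  move=> H; exists U; first by rewrite inE in_orbit.
  exists Phi => v vU.
  have gvU : g v \in U by move: vU; rewrite !inE; apply: mem_orbit.
  case: (own' v); first by exists (g v); [rewrite eg|split=> //; apply: H].
  by move=> w; rewrite eg => /eqP ->; split=> //; apply: H.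
(* The orbit has [m] states and its last edge returns to position [i], so the cycle sum is
   [S m - S i]. *)
pose m := order g x; pose i := findex g x (iter m g x).
have orbE v : v \in orbit g x -> exists2 k, (k < m)%N & v = iter k g x.
  rewrite -fconnect_orbit => vU; exists (findex g x v); first exact: findex_max.
  by rewrite iter_findex.
pose Phi v := S (findex g x v).
have PhiS v : v \in orbit g x ->
    Phi (g v) = Phi v + z v (g v) \/
    (Phi (g v) = S i /\ Phi v + z v (g v) = S m).
  move=> /orbE[k km ->].
  rewrite -iterS /Phi (findex_iter km).
  move: km; rewrite leq_eqVlt => /orP[/eqP km|km]; last by left; rewrite (findex_iter km) SS.
  by right; rewrite -SS km.
case: (leP (S i) (S m)) => [le|/ltW le]; [left|right].
  by apply: (cert _ _ Phi) => v; rewrite inE => vU _; have [->|[-> ->]] := PhiS v vU.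
apply: (cert _ _ (fun v => - Phi v)) => v; rewrite inE => vU _; rewrite /opp_weight.
have [->|[-> E]] := PhiS v vU; first by lra.
by move: E le; lra.
Qed.

(** Induction on the number of edges: the edges at a branching state are split between two smaller
    games, whose certificates are then combined. *)
Theorem energy_dichotomy z own e x : (forall v, exists w, e v w) ->
  energy_win z own e x \/ energy_win (opp_weight z) (predC own) e x.
Proof.
pose sz e0 := (\sum_v #|[pred w | e0 v w]|)%N.
have [n] := ubnP (sz e); elim: n e => // n IHn e /ltnSE szn tot.
have [/existsP[u /existsP[w1 /existsP[w2 /and3P[ew1 ew2 w12]]]]|fe] :=
  boolP [exists u, exists w1, exists w2, [&& e u w1, e u w2 & w1 != w2]].
  pose e1 v w := e v w && ((v != u) || (w != w1)).
  pose e2 v w := e v w && ((v != u) || (w == w1)).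
  have ee1 v w : v != u -> e v w = e1 v w by rewrite /e1 => ->; rewrite andbT.
  have ee2 v w : v != u -> e v w = e2 v w by rewrite /e2 => ->; rewrite andbT.
  have small e' w : (forall v w, v != u -> e v w = e' v w) ->
     (forall w, e' u w -> e u w) -> e u w -> ~~ e' u w -> (sz e' < n)%N.
    move=> ee' sub euw ne'; apply: leq_trans szn; rewrite /sz.
    rewrite (bigD1 u) //= [X in (_ < X)%N](bigD1 u) //= -addSn leq_add //.
      apply: proper_card; apply/fintype.properP; split.
        by apply/fintype.subsetP => y; rewrite !inE => /sub.
      by exists w; rewrite inE.
    apply: leq_sum => v vu; apply: subset_leq_card; apply/fintype.subsetP => y.
    by rewrite !inE ee'.
  have tot1 v : exists w, e1 v w.
    have [->|vu] := eqVneq v u.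
      by exists w2; rewrite /e1 ew2 eqxx eq_sym w12.
    by have [w ew] := tot v; exists w; rewrite -ee1.
  have tot2 v : exists w, e2 v w.
    have [->|vu] := eqVneq v u.
      by exists w1; rewrite /e2 ew1 !eqxx.
    by have [w ew] := tot v; exists w; rewrite -ee2.
  have sub1 w : e1 u w -> e u w by rewrite /e1; case: (e u w).
  have sub2 w : e2 u w -> e u w by rewrite /e2; case: (e u w).
  have cov w : e u w -> e1 u w || e2 u w.
    by rewrite /e1 /e2 => ->; rewrite eqxx /=; case: eqP.
  have s1 : (sz e1 < n)%N.
    by apply: (small _ w1) => //; rewrite /e1 !eqxx andbF.
  have s2 : (sz e2 < n)%N.
    by apply: (small _ w2) => //; rewrite /e2 eqxx eq_sym (negbTE w12) andbF.
  (* If one player wins both games, either it owns [u] and picks one of them, or the two potentials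
     are merged. If the winners differ, the owner of [u] keeps to the game that it wins. *)
  have [W1|L1] := IHn _ s1 tot1; have [W2|L2] := IHn _ s2 tot2.
  - have [ou|ou] := boolP (own u); left; first exact: energy_win_own ou ee1 sub1 W1.
    exact: energy_win_opp ou ee1 ee2 cov W1 W2.
  - have [ou|ou] := boolP (own u); first by left; exact: energy_win_own ou ee1 sub1 W1.
    by right; exact: (energy_win_own (own := predC own) ou ee2 sub2 L2).
  - have [ou|ou] := boolP (own u); first by left; exact: energy_win_own ou ee2 sub2 W2.
    by right; exact: (energy_win_own (own := predC own) ou ee1 sub1 L1).
  - right; have [ou|ou] := boolP (own u).
      by apply: (energy_win_opp (own := predC own) _ ee1 ee2 cov L1 L2); rewrite /= ou.
    exact: (energy_win_own (own := predC own) ou ee1 sub1 L1).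
(* No branching state is left, so [e] is the graph of a function. *)
have ex v : exists w, e v w by exact: tot.
pose g v := xchoose (ex v).
apply: (@energy_dichotomy_fun _ _ _ g) => v w.
apply/idP/eqP => [ew|->]; last exact: xchooseP.
apply/eqP; apply: contraNT fe => ne; apply/existsP; exists v; apply/existsP; exists w.
by apply/existsP; exists (g v); rewrite ew ne (xchooseP (ex v)).
Qed.

(* A potential rising by at most [b] per step cannot drop infinitely often by
   more than it can regain along a shortest path back to the same state. *)
Lemma no_infinite_drop (Phi : T -> R) (b M : R) (x : nat -> T) (K0 : nat)
    (D : pred nat) :
  0 <= b -> b *+ #|T| < M ->
  (forall k, (K0 <= k)%N -> Phi (x k.+1) <= Phi (x k) + b) ->
  (forall k, (K0 <= k)%N -> D k -> Phi (x k.+1) <= Phi (x k) - M) ->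
  exists K, forall k, (K <= k)%N -> ~~ D k.
Proof.
move=> b0 bM step drop; apply: contrapT => inf.
have infD K : exists k, (K <= k)%N && D k.
  apply: contrapT => H; apply: inf; exists K => k Kk.
  by apply/negP => Dk; apply: H; exists k; rewrite Kk.
(* By the pigeonhole principle, infinitely many drops start from one state. *)
have [v vinf] : exists v, forall K, exists k, [&& K <= k, D k & x k == v]%N.
  apply: contrapT => H.
  have {}H v : exists K, forall k, (K <= k)%N -> D k -> x k != v.
    apply: contrapT => Hv; apply: H; exists v => K; apply: contrapT => HK.
    apply: Hv; exists K => k Kk Dk; apply/negP => xk; apply: HK.
    by exists k; rewrite Kk Dk.
  have /choice[B HB] := H.
  have [k /andP[Kk Dk]] := infD (\max_v B v)%N.
  by have := HB (x k) k (leq_trans (leq_bigmax (x k)) Kk) Dk; rewrite eqxx.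
have [k /and3P[K0k Dk /eqP xk]] := vinf K0.
have [k' /and3P[kk' _ /eqP xk']] := vinf k.+1.
(* The later steps of the sequence are edges of this graph, so the return to [v] can be shortened to
   a simple path, which regains at most [b *+ #|T|]. *)
pose e := [rel u w | Phi w <= Phi u + b].
have pathP m : exists2 p, path e (x k.+1) p & last (x k.+1) p = x (k.+1 + m)%N.
  elim: m => [|m [p pp lp]]; first by exists [::]; rewrite ?addn0.
  exists (rcons p (x (k.+1 + m.+1)%N)); last by rewrite last_rcons.
  by rewrite rcons_path pp lp /= addnS step // (leq_trans K0k) // addSn ltnW // ltnS leq_addr.
have [p pp] := pathP (k' - k.+1)%N.
rewrite subnKC // xk'; case/shortenP: pp => p' pp' up' _ lp'.
have pathle u q : path e u q -> Phi (last u q) <= Phi u + b *+ size q.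
  elim: q u => [|w q IH] u /=; first by rewrite mulr0n addr0.
  move=> /andP[le /IH le']; rewrite mulrS; lra.
have szp : (size p' <= #|T|)%N.
  by have := card_uniqP up'; move: (max_card (mem (x k.+1 :: p'))) => /[swap] -> /ltnW.
have := pathle _ _ pp'; rewrite lp'.
have := drop k K0k Dk; rewrite xk.
have : b *+ size p' <= b *+ #|T| by rewrite ler_wpMn2l.
lra.
Qed.

End EnergyGames.

(** * Threshold characterisations of the limit inferior *)

Section LimnEinf.
Variable R : realType.
Implicit Types (u : nat -> R) (a b : R).

Lemma limn_einf_sup_einfs (f : nat -> \bar R) :
  limn_einf f = ereal_sup (range (einfs f)).
Proof. by rewrite limn_einf_lim; apply/cvg_lim => //; exact: cvg_einfs_sup. Qed.

Lemma limn_einf_ge u b N : (forall n, (N <= n)%N -> b <= u n) ->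
  (b%:E <= limn_einf (fun n => (u n)%:E))%E.
Proof.
move=> H; rewrite limn_einf_sup_einfs.
apply: le_trans (ereal_sup_ubound _); last by exists N.
by apply: le_ereal_inf_tmp => _ [n /= Nn <-]; rewrite lee_fin H.
Qed.

Lemma lt_limn_einf u b : (b%:E < limn_einf (fun n => (u n)%:E))%E ->
  exists N, forall n, (N <= n)%N -> b <= u n.
Proof.
rewrite limn_einf_sup_einfs => /ereal_sup_gt[_ [N _ <-]] bN; exists N => n Nn.
by rewrite -lee_fin; apply: le_trans (ltW bN) _; apply: ereal_inf_lbound; exists n.
Qed.

Lemma limn_einf_geP u a : (a%:E <= limn_einf (fun n => (u n)%:E))%E <->
  forall eps, 0 < eps -> exists N, forall n, (N <= n)%N -> a - eps <= u n.
Proof.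
split=> [H eps e0|H].
  by apply: lt_limn_einf; apply: lt_le_trans H; rewrite lte_fin; lra.
apply/lee_addgt0Pr => eps e0; have [N HN] := H _ e0.
by rewrite -leeBlDr //; apply: limn_einf_ge HN.
Qed.

Lemma limn_einf_leP u a : (limn_einf (fun n => (u n)%:E) <= a%:E)%E <->
  forall eps, 0 < eps -> forall N, exists2 n, (N <= n)%N & u n <= a + eps.
Proof.
split=> [H eps e0 N|H].
  apply: contrapT => no; have : (limn_einf (fun n => (u n)%:E) < (a + eps)%:E)%E.
    by apply: le_lt_trans H _; rewrite lte_fin; lra.
  rewrite ltNge => /negP; apply; apply: (@limn_einf_ge _ _ N) => n Nn.
  by rewrite leNgt; apply/negP => /ltW lt; apply: no; exists n.
rewrite leNgt; apply/negP => lt.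
have [eps e0 lt'] : exists2 eps, 0 < eps &
    ((a + eps)%:E < limn_einf (fun n => (u n)%:E))%E.
  case: limn_einf lt => [l| |] //.
    by rewrite lte_fin => al; exists ((l - a) / 2); rewrite ?lte_fin; lra.
  by move=> _; exists 1; rewrite ?ltry.
have [N HN] := lt_limn_einf lt'.
have [|n Nn un] := H (eps / 2) _ N; first by lra.
by have := HN n Nn; lra.
Qed.

End LimnEinf.

(** * Weights of walks and of repeated cycles *)

Section WalkSums.
Variables (R : realType) (V : Type) (w : V -> V -> R).
Implicit Types (rho : nat -> V) (x y : V) (p q c s : seq V).

Fixpoint wsum x p : R := if p is y :: p' then w x y + wsum y p' else 0.

Definition psum rho n : R := \sum_(k < n) w (rho k) (rho k.+1).

(** The closing edge is counted first, so that each copy of [c] following another copy contributes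
    exactly this amount. *)
Definition csum c : R := if c is y :: c' then w (last y c') y + wsum y c' else 0.

Lemma psum0 rho : psum rho 0 = 0. Proof. by rewrite /psum big_ord0. Qed.

Lemma psumS rho n : psum rho n.+1 = psum rho n + w (rho n) (rho n.+1).
Proof. by rewrite /psum big_ord_recr. Qed.

Lemma wsum_cat x p q : wsum x (p ++ q) = wsum x p + wsum (last x p) q.
Proof. by elim: p x => [|y p IH] x /=; rewrite ?add0r // IH addrA. Qed.

Lemma psum_wsum rho L x p :
  (forall j, (j <= size p)%N -> rho (L + j)%N = nth x (x :: p) j) ->
  psum rho (L + size p) = psum rho L + wsum x p.
Proof.
elim: p x L => [|y p IH] x L H /=; first by rewrite addn0 addr0.
have H0 := H 0%N isT; have H1 := H 1%N isT.
rewrite addnS -addSn (IH y); last first.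
  move=> j jp; rewrite addSnnS H //; apply: set_nth_default; exact: jp.
by rewrite psumS addrA -[in rho L](addn0 L) H0 -addn1 H1.
Qed.

Lemma catstream_shift s rho n : catstream s rho (size s + n) = rho n.
Proof. by rewrite /catstream ltnNge leq_addr addKn. Qed.

Lemma psum_catstream s rho n : psum (catstream s rho) (size s + n) =
  psum (catstream s rho) (size s) + psum rho n.
Proof.
elim: n => [|n IH]; first by rewrite addn0 psum0 addr0.
by rewrite addnS !psumS IH addrA -addnS !catstream_shift.
Qed.

Variable B : R.
Hypothesis wB : forall x y, `|w x y| <= B.

Lemma wbound_ge0 x : 0 <= B. Proof. exact: le_trans (wB x x). Qed.

Lemma wsum_bound x p : `|wsum x p| <= B *+ size p.
Proof.
elim: p x => [|y p IH] x /=; first by rewrite normr0.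
by rewrite mulrS (le_trans (ler_normD _ _)) // lerD.
Qed.

Lemma psum_bound rho n : `|psum rho n| <= B *+ n.
Proof.
elim: n => [|n IH]; first by rewrite psum0 normr0.
by rewrite psumS mulrSr (le_trans (ler_normD _ _)) // lerD.
Qed.

(** Only the entry into the first copy differs, its edge starting at [x] instead of the last vertex
    of [c]; the error is a difference of two weights for every [n]. *)
Lemma wsum_ncat x c n :
  `|wsum x (ncat n c) - csum c *+ n| <= B *+ 2.
Proof.
case: c => [|y c] /=.
  have -> : ncat n [::] = [::] :> seq V by elim: n.
  by rewrite /= mul0rn subrr normr0 mulrn_wge0 // (wbound_ge0 x).
suff -> : wsum x (ncat n (y :: c)) - (w (last y c) y + wsum y c) *+ n =
    if n is 0 then 0 else w x y - w (last y c) y.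
  case: n => [|n]; first by rewrite normr0 mulrn_wge0 // (wbound_ge0 x).
  by rewrite mulr2n (le_trans (ler_normB _ _)) // lerD.
elim: n x => [|n IH] x /=; first by rewrite subrr.
rewrite wsum_cat mulrS; have := IH (last y c).
case: n {IH} => [|n]; lra.
Qed.

Lemma take_ncat m n c :
  exists j k, (j <= n)%N /\ take m (ncat n c) = ncat j c ++ take k c.
Proof.
elim: n m => [|n IH] m /=; first by exists 0%N, 0%N; rewrite take0.
rewrite take_cat; case: ltnP => mc; first by exists 0%N, m.
have [j [k [jn ->]]] := IH (m - size c)%N.
by exists j.+1, k; split=> //=; rewrite catA.
Qed.

(** A prefix of the repetitions is made of full copies, which lose at most the entry error, and of
    part of one copy. *)
Lemma wsum_take_ncat x c m n : 0 <= csum c ->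
  - (B *+ (2 + size c)) <= wsum x (take m (ncat n c)).
Proof.
move=> c0; have [j [k [_ ->]]] := take_ncat m n c.
rewrite wsum_cat mulrnDr opprD lerD //.
  have := wsum_ncat x c j; rewrite ler_norml => /andP[+ _].
  have : 0 <= csum c *+ j by rewrite mulrn_wge0.
  lra.
have := wsum_bound (last x (ncat j c)) (take k c); rewrite ler_norml => /andP[+ _].
apply: le_trans; rewrite lerN2 ler_wpMn2l ?(wbound_ge0 x) //.
by rewrite size_take_min geq_minr.
Qed.

End WalkSums.

(** * Mean-payoff thresholds as bounds on shifted sums *)

Section MeanPayoffThreshold.
Variables (R : realType) (Pl V : finType) (r : Pl -> V -> V -> rat).
Implicit Types (rho : nat -> V).

Definition wgt (alpha : R) (j : Pl) (x y : V) : R := ratr (r j x y) - alpha.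

Lemma psum_wgt alpha j rho n : psum (wgt alpha j) rho n =
  \sum_(k < n) ratr (r j (rho k) (rho k.+1)) - alpha *+ n.
Proof. by rewrite /psum /wgt sumrB sumr_const card_ord. Qed.

(** Subtracting [alpha] from every reward turns the threshold into an energy condition; [C] absorbs
    the finite prefix on which the mean may be too small. *)
Lemma mp_geP alpha j rho : (alpha%:E <= mp R r j rho)%E <->
  forall eps, 0 < eps -> exists C, forall n,
    - C - eps * n%:R <= psum (wgt alpha j) rho n.
Proof.
rewrite /mp; split=> [/limn_einf_geP H eps e0|H].
  have [N HN] := H _ e0.
  exists (\sum_(k < N.+1) `|psum (wgt alpha j) rho k|) => n.
  have [nN|Nn] := leqP n N.
    apply: le_trans (_ : - `|psum (wgt alpha j) rho n| <= _); last first.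
      by rewrite lerNl -normrN ler_norm.
    rewrite (bigD1 (Ordinal (nN : (n < N.+1)%N))) //=.
    have : 0 <= \sum_(k < N.+1 | k != Ordinal (nN : (n < N.+1)%N))
       `|psum (wgt alpha j) rho k| by apply: sumr_ge0.
    have : 0 <= eps * n%:R by rewrite mulr_ge0 // ltW.
    lra.
  case: n Nn => // n /ltnSE /HN; rewrite -ler_pdivrMl ?invrK ?invr_gt0 ?ltr0n //.
  rewrite psum_wgt -mulr_natr.
  have : 0 <= \sum_(k < N.+1) `|psum (wgt alpha j) rho k| by apply: sumr_ge0.
  lra.
apply/limn_einf_geP => eps e0.
have [|C HC] := H (eps / 2); first by lra.
pose K := `|C| / (eps / 2).
have K0 : 0 <= K by rewrite divr_ge0 //; lra.
(* From this index on, [|C|] fits into the remaining error of [eps / 2] per step. *)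
exists (Num.bound K) => n bn.
rewrite -ler_pdivrMl ?invrK ?invr_gt0 ?ltr0n //.
have := HC n.+1; rewrite psum_wgt -mulr_natr.
have : `|C| <= (eps / 2) * n.+1%:R.
  rewrite mulrC -ler_pdivrMr; last by lra.
  apply: le_trans (ltW (archi_boundP K0)) _.
  by rewrite ler_nat (leq_trans bn).
have := ler_norm C.
lra.
Qed.

Lemma mp_leP alpha j rho : (mp R r j rho <= alpha%:E)%E <->
  forall eps, 0 < eps -> exists C, forall N, exists2 n, (N <= n)%N &
    psum (wgt alpha j) rho n <= C + eps * n%:R.
Proof.
rewrite /mp; split=> [/limn_einf_leP H eps e0|H].
  exists 0 => N; have [n Nn] := H _ e0 N.
  rewrite -ler_pdivlMl ?invrK ?invr_gt0 ?ltr0n // => le.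
  exists n.+1; first exact: leqW.
  by rewrite psum_wgt -mulr_natr; lra.
apply/limn_einf_leP => eps e0 N.
have [|C HC] := H (eps / 2); first by lra.
pose K := `|C| / (eps / 2).
have K0 : 0 <= K by rewrite divr_ge0 //; lra.
have [n] := HC (maxn N (Num.bound K)).+1.
case: n => // n; rewrite ltnS geq_max => /andP[Nn bn].
rewrite psum_wgt -mulr_natr => le; exists n => //.
rewrite -ler_pdivlMl ?invrK ?invr_gt0 ?ltr0n //.
have : `|C| <= (eps / 2) * n.+1%:R.
  rewrite mulrC -ler_pdivrMr; last by lra.
  apply: le_trans (ltW (archi_boundP K0)) _.
  by rewrite ler_nat (leq_trans bn).
have := ler_norm C.
lra.
Qed.

Lemma mp_catstream_ge alpha j s rho :
  (alpha%:E <= mp R r j rho)%E -> (alpha%:E <= mp R r j (catstream s rho))%E.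
Proof.
move=> /mp_geP H; apply/mp_geP => eps e0; have [C HC] := H _ e0.
pose w := wgt alpha j; pose t := catstream s rho.
exists (`|C| + \sum_(k < (size s).+1) `|psum w t k|) => n.
have le0 m : (m <= size s)%N ->
    - (\sum_(k < (size s).+1) `|psum w t k|) <= psum w t m.
  move=> ms; apply: le_trans (_ : - `|psum w t m| <= _); last first.
    by rewrite lerNl -normrN ler_norm.
  rewrite (bigD1 (Ordinal (ms : (m < (size s).+1)%N))) //= lerN2 lerDl.
  exact: sumr_ge0.
have [ns|/ltnW sn] := leqP n (size s).
  have := le0 n ns; have : 0 <= eps * n%:R by rewrite mulr_ge0 // ltW.
  by have := normr_ge0 C; lra.
rewrite -(subnKC sn) psum_catstream natrD.
have := HC (n - size s)%N; have := le0 _ (leqnn _); have := ler_norm C.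
have : 0 <= eps * (size s)%:R by rewrite mulr_ge0 // ltW.
by rewrite mulrDr; lra.
Qed.

Lemma mp_catstream_le alpha j s rho :
  (mp R r j rho <= alpha%:E)%E -> (mp R r j (catstream s rho) <= alpha%:E)%E.
Proof.
move=> /mp_leP H; apply/mp_leP => eps e0; have [C HC] := H _ e0.
exists (psum (wgt alpha j) (catstream s rho) (size s) + C) => N.
have [n Nn le] := HC N; exists (size s + n)%N; first by rewrite (leq_trans Nn) // leq_addl.
rewrite psum_catstream natrD mulrDr.
have : 0 <= eps * (size s)%:R by rewrite mulr_ge0 // ltW.
lra.
Qed.

End MeanPayoffThreshold.

(** * A finite arena for the reduced negotiation game *)

Section FiniteArena.
Variables (R : realType) (Pl V : finType) (E : rel V) (owner : V -> Pl).
Variables (r : Pl -> V -> V -> rat) (lam : V -> \bar R) (i : Pl) (beta : nat).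

Local Notation rtrans := (rtrans E owner r lam i beta).
Local Notation SPre := (@SPre Pl V).
Local Notation SPost := (@SPost Pl V).

(** A size at most [beta] keeps numerator and denominator below or equal to [2 ^ beta] in absolute
    value; the Boolean is the sign. *)
Definition rat_code := ('I_(2 ^ beta).+1 * 'I_(2 ^ beta).+1 * bool)%type.

Definition rat_dec (t : rat_code) : rat :=
  (-1) ^+ t.2 * (t.1.1 : nat)%:R / (t.1.2 : nat)%:R.

Lemma rat_dec_onto q : (rat_size q <= beta)%N -> exists t, rat_dec t = q.
Proof.
rewrite /rat_size => sz.
have bound m : (up_log 2 (m + 1) <= beta)%N -> (m < (2 ^ beta).+1)%N.
  move=> le; have := @up_logP 2 (m + 1) isT.
  have : (2 ^ up_log 2 (m + 1) <= 2 ^ beta)%N by rewrite leq_exp2l.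
  lia.
have num_lt : (`|numq q|%N < (2 ^ beta).+1)%N by apply: bound; lia.
have den_lt : (`|denq q|%N < (2 ^ beta).+1)%N by apply: bound; lia.
exists (Ordinal num_lt, Ordinal den_lt, numq q < 0); rewrite /rat_dec /=.
rewrite -[RHS]divq_num_den; congr (_ / _).
  by rewrite {3}[numq q]intEsign rmorphM rmorphXn /= rmorphN1 pmulrn.
by rewrite pmulrn absz_denq.
Qed.

(** Simple histories and simple cycles repeat no vertex, so sequences of length at most [#|V|]
    suffice. *)
Definition fam_code :=
  (#|V|.-bseq V * #|V|.-bseq V * {set V} * {ffun Pl -> rat_code})%type.

Definition fam_dec (a : fam_code) : pun_family Pl V :=
  PunFamily a.1.1.1 a.1.1.2 a.1.2 [ffun j => rat_dec (a.2 j)].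

Lemma fam_dec_onto f : valid_family E owner r lam beta f ->
  exists a, f = fam_dec a.
Proof.
case: f => h c W x [[_ /= uh] [_ [uc _]] _ _ /= sz].
have le (s : seq V) : uniq s -> (size s <= #|V|)%N.
  by move=> /card_uniqP <-; exact: max_card.
have /choice[g gE] : forall j, exists t, rat_dec t = x j.
  move=> j; apply: rat_dec_onto; apply: leq_trans sz.
  by rewrite /vec_size (bigD1 j) //=; lia.
exists (Bseq (le _ uh), Bseq (le _ uc), W, [ffun j => g j]).
by congr PunFamily; apply/ffunP => j; rewrite !ffunE gE.
Qed.

(** [Some k] is the pre-cycle deviation after [k.+1] vertices of [hc], [None] a post-cycle
    deviation; the vertex is the target. *)
Definition dev_code := (option 'I_(#|V| + #|V|) * V)%type.

Definition dev_dec (a : fam_code) (o : dev_code) : rstate Pl V :=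
  if o.1 is Some k then SPre (take k.+1 (fh (fam_dec a) ++ fc (fam_dec a))) o.2
  else SPost (fc (fam_dec a)) o.2.

Lemma dev_dec_onto a s : rtrans (SFam (fam_dec a)) s ->
  s = STop Pl V \/ exists o, s = dev_dec a o.
Proof.
case: s => //= [c u [-> _]|h' w [h0 /prefixP[t ht] _ _]|_]; last by left.
  by right; exists (None, u).
have lt : ((size h').-1 < #|V| + #|V|)%N.
  have := congr1 size ht; rewrite !size_cat.
  have := size_bseq a.1.1.1; have := size_bseq a.1.1.2.
  case: h' h0 {ht} => //= x h' _; lia.
right; exists (Some (Ordinal lt), w); rewrite /dev_dec /= ht.
by rewrite prednK ?take_size_cat //; case: h' h0 {ht lt}.
Qed.

Definition proposes v a := rtrans (SProver Pl v) (SFam (fam_dec a)).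
Definition deviates a o := rtrans (SFam (fam_dec a)) (dev_dec a o).

Section Threshold.
Variable alpha : R.
Local Notation w := (wgt r alpha i).

Definition step_bound : R := \sum_x \sum_y `|w x y|.

Lemma step_boundP x y : `|w x y| <= step_bound.
Proof.
rewrite /step_bound (bigD1 x) //= (bigD1 y) //= -addrA lerDl.
by rewrite addr_ge0 ?sumr_ge0 // => z _; apply: sumr_ge0.
Qed.

Lemma step_bound_ge0 : 0 <= step_bound.
Proof. by do 2!apply: sumr_ge0 => ? _. Qed.

Definition pre_bound : R := step_bound *+ (#|V| + #|V|).+1.

(* A good cycle outweighs the pre-deviations of any simple loop, and a bad cycle
   outweighs the good cycles and pre-deviations of any simple loop. *)
Definition good_weight : R := pre_bound *+ #|V| + 1.
Definition bad_weight : R := (pre_bound + good_weight) *+ #|V| + 1.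

Lemma pre_bound_ge0 : 0 <= pre_bound.
Proof. exact: mulrn_wge0 step_bound_ge0. Qed.

Lemma good_weight_ge0 : 0 <= good_weight.
Proof. by apply: addr_ge0 => //; apply: mulrn_wge0; exact: pre_bound_ge0. Qed.

Lemma bad_weight_ge0 : 0 <= bad_weight.
Proof.
apply: addr_ge0 => //; apply: mulrn_wge0.
exact: addr_ge0 pre_bound_ge0 good_weight_ge0.
Qed.

Definition good_cycle a := 0 <= csum w (fc (fam_dec a)).

(** The true sum of a post-cycle deviation depends on the past through [N ^ 2]. The arena needs a
    weight known from the code alone, so only the sign of the cycle is kept. *)
Definition dev_weight a (o : dev_code) : R :=
  if o.1 is Some k then
    let h' := take k.+1 (fh (fam_dec a) ++ fc (fam_dec a)) in
    wsum w (head o.2 h') (rcons (behead h') o.2)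
  else if good_cycle a then good_weight else - bad_weight.

Lemma dev_weight_pre a k u : `|dev_weight a (Some k, u)| <= pre_bound.
Proof.
apply: le_trans (wsum_bound step_boundP _ _) _.
rewrite ler_wpMn2l ?step_bound_ge0 // size_rcons size_behead ltnS.
rewrite (leq_trans (leq_pred _)) // size_take_min geq_min size_cat.
by rewrite leq_add ?size_bseq ?orbT.
Qed.

(** A state may have several codes; this allows a play to be compared with a certificate that uses
    other codes. *)
Lemma dev_weight_dec a a' o o' : fam_dec a = fam_dec a' ->
  dev_dec a o = dev_dec a' o' -> dev_weight a o = dev_weight a' o'.
Proof.
move=> fE; rewrite /dev_dec /dev_weight /good_cycle fE.
by case: o o' => [[j|] u] [[j'|] u'] //= [] // -> ->.
Qed.

(* Accepting and giving up become self-loops whose sign decides the winner. *)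
Let state := (V + (option fam_code + dev_code))%type.

Let edge : rel state := fun s s' => match s, s' with
  | inl v, inr (inl (Some a)) => `[< proposes v a >]
  | inl _, inr (inl None) => true
  | inr (inl None), inr (inl None) => true
  | inr (inl (Some a)), inr (inl (Some a')) => a' == a
  | inr (inl (Some a)), inr (inr o) => `[< deviates a o >]
  | inr (inr o), inl v => v == o.2
  | _, _ => false
  end.

Let weight (s s' : state) : R := match s, s' with
  | inr (inl None), _ => 1
  | inr (inl (Some a)), inr (inl _) =>
      if alpha <= ratr (fx (fam_dec a) i) then 1 else -1
  | inr (inl (Some a)), inr (inr o) => dev_weight a o
  | _, _ => 0
  end.

(** This certificate and the next compose the three moves of a round into one inequality between
    vertices. *)
Definition challenger_cert (U : {set V}) (Phi : V -> R) :=
  forall v a, v \in U -> proposes v a -> alpha <= ratr (fx (fam_dec a) i) \/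
    exists2 o, deviates a o & o.2 \in U /\ Phi o.2 <= Phi v + dev_weight a o.

Definition prover_cert (U : {set V}) (Phi : V -> R) (sg : V -> option fam_code) :=
  forall v, v \in U -> exists a, [/\ sg v = Some a, proposes v a,
    ratr (fx (fam_dec a) i) < alpha & forall o, deviates a o ->
    o.2 \in U /\ Phi o.2 <= Phi v - dev_weight a o].

Lemma arena_dichotomy v0 :
  (exists2 U : {set V}, v0 \in U & exists Phi, challenger_cert U Phi) \/
  (exists2 U : {set V}, v0 \in U & exists Phi sg, prover_cert U Phi sg).
Proof.
pose own : pred state := fun s => if s is inl _ then false else true.
have tot s : exists s', edge s s'.
  case: s => [v|[[a|]|o]]; first by exists (inr (inl None)).
  - by exists (inr (inl (Some a))); rewrite /= eqxx.
  - by exists (inr (inl None)).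
  - by exists (inl o.2); rewrite /= eqxx.
have [[U xU [Phi cert]]|[U xU [Phi cert]]] :=
  energy_dichotomy weight own (inl v0) tot; [left|right];
  (exists [set v | inl v \in U]; first by rewrite inE); exists (Phi \o inl).
  move=> v a; rewrite inE => vU pva.
  have [|aU le] := cert _ vU (inr (inl (Some a))); first exact/asboolP.
  have [[|[[a'|]|o]] //= ea [sU le']] := cert _ aU.
    (* No potential can cross a self-loop of weight [-1], so accepting is prescribed only when the
       proposed payoff reaches [alpha]. *)
    move/eqP: ea le' => ->.
    by case: ifP => [|_]; [left|rewrite -subr_ge0; lra].
  right; exists o; first exact/asboolP.
  have [[u|] //= /eqP -> [uU le'']] := cert _ sU.
  by rewrite inE; split=> //; move: le le' le'' => /=; lra.
have prop v : inl v \in U -> exists a, [/\ proposes v a,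
    ratr (fx (fam_dec a) i) < alpha & forall o, deviates a o ->
    inl o.2 \in U /\ Phi (inl o.2) <= Phi (inl v) - dev_weight a o].
  move=> vU; have [[|[[a|]|o]] //= ea [sU le]] := cert _ vU.
    exists a; split; first exact/asboolP.
      have [|_] := cert _ sU (inr (inl (Some a))); first by rewrite /= eqxx.
      by rewrite /opp_weight /=; case: leP => // _; lra.
    move=> o dev; have [|oU le'] := cert _ sU (inr (inr o)); first exact/asboolP.
    have [|uU le''] := cert _ oU (inl o.2); first by rewrite /= eqxx.
    by split=> //; move: le le' le''; rewrite /opp_weight /=; lra.
  (* Prover cannot give up here: with negated weights, the loop after giving up has weight [-1]. *)
  by have [//|_] := cert _ sU (inr (inl None)); rewrite /opp_weight /=; lra.
have /choice[sg sgP] : forall v, exists oa, inl v \in U -> exists a,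
   [/\ oa = Some a, proposes v a,
    ratr (fx (fam_dec a) i) < alpha & forall o, deviates a o ->
    inl o.2 \in U /\ Phi (inl o.2) <= Phi (inl v) - dev_weight a o].
  move=> v; have [/prop[a [p1 p2 p3]]|nU] := boolP (inl v \in U); last by exists None.
  by exists (Some a) => _; exists a.
exists sg => v; rewrite inE => /sgP[a [p0 p1 p2 p3]]; exists a; split=> // o /p3[].
by rewrite inE.
Qed.

End Threshold.
End FiniteArena.

(** * Sequence lemmas and an error estimate *)

Lemma size_ncat T n (s : seq T) : size (ncat n s) = (n * size s)%N.
Proof. by elim: n => // n IH /=; rewrite size_cat IH mulSn. Qed.

Lemma take_catD T m (p q : seq T) :
  take m (p ++ q) = take m p ++ take (m - size p) q.
Proof.
rewrite take_cat; case: ltnP => mp; last by rewrite (take_oversize mp).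
have -> : (m - size p = 0)%N by lia.
by rewrite take0 cats0.
Qed.

Lemma size_take_le T m (p : seq T) : (size (take m p) <= size p)%N.
Proof. by rewrite size_take_min geq_minr. Qed.

Lemma potential_bound (R : realType) (V : finType) (Phi : V -> R) u : `|Phi u| <= \sum_x `|Phi x|.
Proof. by rewrite (bigD1 u) //= lerDl sumr_ge0. Qed.

(* A sublinear error [D * N] is absorbed by [eps * n] as soon as [N ^ 2 <= n]. *)
Lemma sqrt_absorb (R : realType) (D eps : R) N n : 0 < eps -> (N ^ 2 <= n)%N ->
  D * N%:R <= D ^+ 2 / eps + eps * n%:R.
Proof.
move=> e0 Nn; have e1 : eps * N%:R ^+ 2 <= eps * n%:R.
  by rewrite ler_pM2l // -natrX ler_nat.
have e2 : D ^+ 2 / eps = eps * (D / eps) ^+ 2 by field; rewrite gt_eqF.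
have e3 : D * N%:R = eps * (D / eps * N%:R) by field; rewrite gt_eqF.
have e4 : eps * (D / eps * N%:R) <= eps * ((D / eps) ^+ 2 + N%:R ^+ 2).
  by rewrite ler_pM2l //; nra.
by rewrite e3 e2; lra.
Qed.

(** * Payoffs of endless sequences of deviations *)

Section DeviationSequences.
Variables (R : realType) (Pl V : finType) (E : rel V) (owner : V -> Pl).
Variables (r : Pl -> V -> V -> rat) (lam : V -> \bar R) (i : Pl) (beta : nat).
Variables (v0 : V) (sel : pun_family Pl V -> V -> seq V).

Local Notation fam_code := (fam_code Pl V beta).
Local Notation dev_code := (dev_code V).
Local Notation proposes := (@proposes R Pl V E owner r lam i beta).

Variables (v : nat -> V) (a : nat -> fam_code) (o : nat -> dev_code).
Hypothesis prop_va : forall k, proposes (v k) (a k).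
Hypothesis next_v : forall k, (o k).2 = v k.+1.

(** One step here is a whole round of the reduced game: proposal, deviation and return to a
    vertex. *)
Fixpoint dev_hist_seq k : seq V := if k is k'.+1 then
    let s := dev_hist_seq k' in
    s ++ piece sel s (SFam (fam_dec (a k'))) (dev_dec (a k') (o k'))
  else [::].

Local Notation len k := (size (dev_hist_seq k)).

Let h k := fh (fam_dec (a k)).
Let c k := fc (fam_dec (a k)).
Let nrep k := ((len k + size (h k)) ^ 2)%N.

Definition dev_piece k := if (o k).1 is Some j then take j.+1 (h k ++ c k)
  else h k ++ ncat (nrep k) (c k) ++ sel (fam_dec (a k)) (v k.+1).

Lemma dev_hist_seqS k : dev_hist_seq k.+1 = dev_hist_seq k ++ dev_piece k.
Proof.
rewrite /= /dev_piece /dev_dec; case: (o k).1 => //=.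
by rewrite size_cat next_v.
Qed.

Lemma fam_head k : h k = v k :: behead (h k).
Proof. by have [_ [+ +]] := prop_va k; rewrite /h; case: fh => //= x s ->. Qed.

Lemma fam_cycle_neq0 k : (0 < size (c k))%N.
Proof. by have [[_ [+ _] _ _ _] _] := prop_va k; rewrite /c; case: fc. Qed.

Lemma dev_piece_head k : dev_piece k = v k :: behead (dev_piece k).
Proof. by rewrite /dev_piece; case: (o k).1 => [j|]; rewrite fam_head. Qed.

Lemma lenS k : len k.+1 = (len k + size (dev_piece k))%N.
Proof. by rewrite dev_hist_seqS size_cat. Qed.

Lemma dev_piece_gt0 k : (0 < size (dev_piece k))%N.
Proof. by rewrite dev_piece_head. Qed.

Lemma leq_len k : (k <= len k)%N.
Proof. elim: k => // k IH; rewrite lenS; have := dev_piece_gt0 k; lia. Qed.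

Lemma len_mono k k' : (k <= k')%N -> (len k <= len k')%N.
Proof.
move=> /subnK <-; elim: (k' - k)%N => // d IH.
by rewrite addSn lenS (leq_trans IH) // leq_addr.
Qed.

Lemma len_split n : exists k m, (m < size (dev_piece k))%N /\ n = (len k + m)%N.
Proof.
elim: n => [|n [k [m [mk ->]]]]; first by exists 0%N, 0%N; rewrite dev_piece_gt0.
have [mk'|km] := ltnP m.+1 (size (dev_piece k)).
  by exists k, m.+1; rewrite addnS.
exists k.+1, 0%N; rewrite dev_piece_gt0 lenS; split=> //; lia.
Qed.

Definition posts k := (\sum_(j < k) ((o j).1 == None))%N.

Lemma postsS k : posts k.+1 = (posts k + ((o k).1 == None))%N.
Proof. by rewrite /posts big_ord_recr. Qed.

(* Each post-cycle deviation at least squares the length of the play. *)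
Lemma posts_sqr k : (posts k ^ 2 <= len k)%N.
Proof.
elim: k => [|k IH]; first by rewrite /posts big_ord0.
rewrite postsS lenS /dev_piece; case: (o k).1 => [j|] /=; first by rewrite addn0; lia.
rewrite !size_cat size_ncat /nrep fam_head /=; have := fam_cycle_neq0 k.
move: (size _) (size _) (size _) (size _) IH => l n1 n2 n3; nia.
Qed.

Variable rho : nat -> V.
Hypothesis rho_hist : forall k n, (n < len k)%N -> rho n = nth v0 (dev_hist_seq k) n.

Lemma rho_piece k j : (j < size (dev_piece k))%N ->
  rho (len k + j) = nth (v k) (dev_piece k) j.
Proof.
move=> jk; rewrite (rho_hist (k := k.+1)); last by rewrite lenS ltn_add2l.
rewrite dev_hist_seqS nth_cat ltnNge leq_addr /= addKn.
exact: set_nth_default.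
Qed.

Lemma rho_len k : rho (len k) = v k.
Proof. by rewrite -[in LHS](addn0 (len k)) rho_piece ?dev_piece_gt0 // dev_piece_head. Qed.

(** Started at [v k], this walk includes the edge into the next piece, so that consecutive walks
    cover all edges of [rho]. *)
Definition dev_walk k := rcons (behead (dev_piece k)) (v k.+1).

Lemma size_dev_walk k : size (dev_walk k) = size (dev_piece k).
Proof. by rewrite size_rcons dev_piece_head. Qed.

Variable alpha : R.
Local Notation w := (wgt r alpha i).
Local Notation S := (psum w rho).
Local Notation B := (step_bound r i alpha).
Local Notation bpre := (pre_bound r i alpha).
Local Notation bgood := (good_weight r i alpha).
Local Notation bbad := (bad_weight r i alpha).
Local Notation cgood := (good_cycle r i alpha).
Local Notation wdev := (dev_weight r i alpha).
Let wB := step_boundP r i alpha.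

Lemma psum_piece k m : (m <= size (dev_piece k))%N ->
  S (len k + m) = S (len k) + wsum w (v k) (take m (dev_walk k)).
Proof.
move=> mk; have szm : size (take m (dev_walk k)) = m.
  by rewrite size_takel // size_dev_walk.
rewrite -{1}szm (@psum_wsum _ _ _ _ _ (v k)) // szm => j jm.
have -> : nth (v k) (v k :: take m (dev_walk k)) j =
          nth (v k) (v k :: dev_walk k) j.
  by case: j jm => //= j jm; rewrite nth_take.
have -> : v k :: dev_walk k = rcons (dev_piece k) (v k.+1).
  by rewrite /dev_walk -rcons_cons -dev_piece_head.
rewrite nth_rcons; case: ltnP => [lt|ge]; first exact: rho_piece.
have -> : j = size (dev_piece k) by lia.
by rewrite eqxx -lenS rho_len.
Qed.

Lemma psum_lenS k : S (len k.+1) = S (len k) + wsum w (v k) (dev_walk k).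
Proof. by rewrite lenS psum_piece // -size_dev_walk take_size. Qed.

Lemma wsum_dev_pre k j : (o k).1 = Some j ->
  wsum w (v k) (dev_walk k) = wdev (a k) (o k).
Proof.
move=> ok; rewrite /wdev ok next_v /dev_walk.
have -> : take j.+1 (fh (fam_dec (a k)) ++ fc (fam_dec (a k))) = dev_piece k.
  by rewrite /dev_piece ok.
by rewrite {2}dev_piece_head.
Qed.

(** Finitely many codes and targets give the selected histories a common length bound, independent
    of the past. *)
Definition sel_bound : nat :=
  (\sum_(b : fam_code) \sum_(u : V) size (sel (fam_dec b) u))%N.

Lemma sel_boundP (b : fam_code) u : (size (sel (fam_dec b) u) <= sel_bound)%N.
Proof. by rewrite /sel_bound (bigD1 b) //= (bigD1 u) //= -addnA leq_addr. Qed.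

(** The summands pay for [h], a truncated repetition of a good cycle, the selected history with the
    edge leaving it, and a pre-cycle deviation. *)
Definition slack : R := B *+ (#|V| + (2 + #|V|) + sel_bound.+1 + (#|V| + #|V|).+1).

Lemma size_h k : (size (h k) <= #|V|)%N. Proof. exact: size_bseq. Qed.
Lemma size_c k : (size (c k) <= #|V|)%N. Proof. exact: size_bseq. Qed.

Lemma wsum_ge x p n : (size p <= n)%N -> - (B *+ n) <= wsum w x p.
Proof.
move=> pn; have := wsum_bound wB x p; rewrite ler_norml => /andP[+ _].
by apply: le_trans; rewrite lerN2 ler_wpMn2l ?step_bound_ge0.
Qed.

Lemma wsum_le x p n : (size p <= n)%N -> wsum w x p <= B *+ n.
Proof.
move=> pn; have := wsum_bound wB x p; rewrite ler_norml => /andP[_].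
by move/le_trans; apply; rewrite ler_wpMn2l ?step_bound_ge0.
Qed.

(** Truncation at any [m] is allowed because a lower bound on a limit inferior must hold at all late
    times, even amid the repetitions. *)
Lemma wsum_dev_ge k m : ((o k).1 != None) || cgood (a k) ->
  - slack <= wsum w (v k) (take m (dev_walk k)).
Proof.
rewrite /dev_walk /dev_piece; case ok: (o k).1 => [j|] /= good.
  rewrite wsum_ge // (leq_trans (size_take_le _ _)) // size_rcons size_behead.
  rewrite (leq_trans _ (leq_addl _ _)) // ltnS (leq_trans (leq_pred _)) //.
  by rewrite (leq_trans (size_take_le _ _)) // size_cat leq_add ?size_h ?size_c.
rewrite fam_head /= -!cats1 -!catA !take_catD !wsum_cat.
rewrite /slack; rewrite 3!mulrnDr.
set p1 := take _ (behead _).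
set n2 := (_ - _)%N; set p3 := take _ (sel _ _); set p4 := take _ [:: _].
have l1 : - (B *+ #|V|) <= wsum w (v k) p1.
  apply: wsum_ge; apply: leq_trans (size_take_le _ _) _.
  by rewrite size_behead (leq_trans (leq_pred _)) // size_h.
set x2 := last _ p1.
have l2 : - (B *+ (2 + #|V|)) <= wsum w x2 (take n2 (ncat (nrep k) (c k))).
  apply: le_trans (wsum_take_ncat wB _ _ _ good).
  by rewrite lerN2 ler_wpMn2l ?step_bound_ge0 // leq_add2l size_c.
set x3 := last x2 _.
have l3 : - (B *+ sel_bound) <= wsum w x3 p3.
  by apply: wsum_ge; apply: leq_trans (size_take_le _ _) (sel_boundP _ _).
have l4 : - B <= wsum w (last x3 p3) p4.
  by apply: (@wsum_ge _ _ 1); apply: size_take_le.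
have l5 : 0 <= B *+ (#|V| + #|V|).+1 by rewrite mulrn_wge0 // step_bound_ge0.
by rewrite (mulrSr B sel_bound); lra.
Qed.

Lemma dev_weight_le k : wdev (a k) (o k) <= bpre + bgood.
Proof.
have := pre_bound_ge0 r i alpha; have := good_weight_ge0 r i alpha.
case: (o k) => [[j|] u] /=.
  by have := dev_weight_pre r i alpha (a k) j u; rewrite ler_norml; lra.
rewrite /wdev /=; case: ifP => _; have := bad_weight_ge0 r i alpha; lra.
Qed.

(** Each bad cycle lowers the potential by more than can be regained, so bad cycles cease. From then
    on the sum follows the potential up to a bounded loss per post-cycle deviation. *)
Lemma dev_seq_mp_ge (Phi : V -> R) :
  (forall k, Phi (v k.+1) <= Phi (v k) + wdev (a k) (o k)) ->
  (alpha%:E <= mp R r i rho)%E.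
Proof.
move=> step.
have pb0 := pre_bound_ge0 r i alpha; have gw0 := good_weight_ge0 r i alpha.
have [K HK] : exists K, forall k, (K <= k)%N ->
    ~~ (((o k).1 == None) && ~~ cgood (a k)).
  apply: (@no_infinite_drop _ _ Phi (bpre + bgood) bbad v 0%N).
  - by rewrite addr_ge0.
  - by rewrite /bad_weight; lra.
  - by move=> k _; apply: le_trans (step k) _; rewrite lerD2l dev_weight_le.
  - move=> k _ /andP[/eqP ok bad]; apply: le_trans (step k) _.
    by rewrite lerD2l /dev_weight ok (negbTE bad).
have good k : (K <= k)%N -> ((o k).1 != None) || cgood (a k).
  by move=> /HK; rewrite negb_and negbK.
have sl0 : 0 <= slack by rewrite /slack mulrn_wge0 // step_bound_ge0.
(* A good post-cycle deviation may raise the potential by [bgood] while the true sum falls by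
   [slack]; both are charged to [posts]. *)
have inv d : S (len K) + Phi (v (K + d)) - Phi (v K)
    - (bgood + slack) * (posts (K + d))%:R <= S (len (K + d)).
  have pos : 0 <= (bgood + slack) * (posts K)%:R.
    by rewrite mulr_ge0 // addr_ge0.
  elim: d => [|d IH]; first by rewrite addn0; lra.
  rewrite addnS psum_lenS postsS natrD mulrDr.
  have := good (K + d)%N (leq_addr _ _).
  have := step (K + d)%N.
  case ok: (o (K + d)%N).1 => [j|] /=.
    by rewrite (wsum_dev_pre ok) mulr0; lra.
  rewrite /dev_weight ok => /[swap] gd; rewrite gd mulr1.
  have := @wsum_dev_ge (K + d)%N (size (dev_walk (K + d))).
  by rewrite gd orbT take_size => /(_ isT); lra.
set P := \sum_x `|Phi x|.
have PhiP u : - P <= Phi u by have := potential_bound Phi u; rewrite ler_norml => /andP[].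
apply/mp_geP => eps e0.
pose D := bgood + slack.
(* [B *+ len K] serves the times up to [len K], the other terms the later ones; [D ^+ 2 / eps] comes
   from [sqrt_absorb]. *)
exists (`|S (len K)| + P + `|Phi (v K)| + slack + D ^+ 2 / eps + B *+ len K) => n.
have P0 : 0 <= P by apply: sumr_ge0.
have D0 : 0 <= D ^+ 2 / eps by rewrite divr_ge0 ?sqr_ge0 // ltW.
have en : 0 <= eps * n%:R by rewrite mulr_ge0 // ltW.
have BK : 0 <= B *+ len K by rewrite mulrn_wge0 // step_bound_ge0.
have n1 := normr_ge0 (S (len K)); have n2 := normr_ge0 (Phi (v K)).
have [nK|Kn] := leqP n (len K).
  have := psum_bound wB rho n; rewrite ler_norml => /andP[+ _].
  have : B *+ n <= B *+ len K by rewrite ler_wpMn2l ?step_bound_ge0.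
  lra.
have [k [m [mk def_n]]] := len_split n.
have Kk : (K <= k)%N.
  rewrite leqNgt; apply/negP => kK; have := len_mono kK; rewrite lenS; lia.
have := inv (k - K)%N; rewrite subnKC // -/D.
have := wsum_dev_ge m (good k Kk).
rewrite def_n psum_piece; last exact: ltnW.
have : D * (posts k)%:R <= D ^+ 2 / eps + eps * (len k + m)%:R.
  by apply: sqrt_absorb => //; rewrite (leq_trans (posts_sqr k)) // leq_addr.
have := PhiP (v k); have := ler_norm (- S (len K)); have := ler_norm (Phi (v K)).
rewrite normrN; lra.
Qed.

(** Here infinitely many times suffice. If bad cycles recur, the times just after their repetitions
    serve. Otherwise only good cycles remain; each lowers the potential too much to recur forever,
    and the final pre-cycle deviations telescope without error. *)
Lemma dev_seq_mp_le (Phi : V -> R) :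
  (forall k, Phi (v k.+1) <= Phi (v k) - wdev (a k) (o k)) ->
  (mp R r i rho <= alpha%:E)%E.
Proof.
move=> step.
have pb0 := pre_bound_ge0 r i alpha; have gw0 := good_weight_ge0 r i alpha.
pose bad k := ((o k).1 == None) && ~~ cgood (a k).
have [infbad|finbad] := pselect (forall K, exists2 k, (K <= k)%N & bad k).
  apply/mp_leP => eps e0.
  exists (B ^+ 2 / eps + B *+ (#|V| + 2)) => K.
  have [k Kk /andP[/eqP ok bd]] := infbad K.
  (* [p] stops after the last copy of the bad cycle. The copies add at most a constant, and their
     number, at least the square of the past length, makes the past negligible. *)
  pose p := behead (h k) ++ ncat (nrep k) (c k).
  have szw : dev_walk k = p ++ rcons (sel (fam_dec (a k)) (v k.+1)) (v k.+1).
    by rewrite /dev_walk /dev_piece ok fam_head /= -rcons_cat catA.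
  have szp : (size p <= size (dev_piece k))%N.
    by rewrite -size_dev_walk szw size_cat leq_addr.
  exists (len k + size p)%N.
    by rewrite (leq_trans Kk) // (leq_trans (leq_len k)) // leq_addr.
  rewrite psum_piece // szw take_size_cat // /p wsum_cat.
  set x := last _ _.
  have l1 := psum_bound wB rho (len k); rewrite ler_norml in l1.
  have l2 : wsum w (v k) (behead (h k)) <= B *+ #|V|.
    by apply: wsum_le; rewrite size_behead (leq_trans (leq_pred _)) // size_h.
  have l3 := wsum_ncat wB x (c k) (nrep k); rewrite ler_norml in l3.
  have l4 : csum w (c k) *+ nrep k <= 0.
    by rewrite mulrn_wle0 //; move: bd; rewrite /good_cycle -ltNge => /ltW.
  have l5 : B * (len k)%:R <= B ^+ 2 / eps + eps * (len k + size p)%:R.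
    apply: sqrt_absorb => //; rewrite size_cat size_ncat /nrep.
    have := fam_cycle_neq0 k; set n1 := size (c k); set n2 := size (h k).
    set n3 := size (behead _); nia.
  rewrite mulr_natr in l5; rewrite -/p mulrnDr; lra.
have [K0 HK0] : exists K0, forall k, (K0 <= k)%N -> ~~ bad k.
  apply: contrapT => H; apply: finbad => K; apply: contrapT => HK; apply: H.
  by exists K => k Kk; apply/negP => bk; apply: HK; exists k.
have good k : (K0 <= k)%N -> (o k).1 = None -> wdev (a k) (o k) = bgood.
  by move=> /HK0 + ok; rewrite /bad /dev_weight ok /= negbK => ->.
have pre k j : (o k).1 = Some j -> `|wdev (a k) (o k)| <= bpre.
  by case: (o k) => -[j'|] u //= _; apply: dev_weight_pre.
have [K HK] : exists K, forall k, (K <= k)%N -> ~~ ((o k).1 == None).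
  apply: (@no_infinite_drop _ _ Phi bpre bgood v K0) => //.
  - by rewrite /good_weight; lra.
  - move=> k K0k; apply: le_trans (step k) _.
    case ok: (o k).1 => [j|]; first by have := pre _ _ ok; rewrite ler_norml; lra.
    by rewrite good //; lra.
  - by move=> k K0k /eqP ok; apply: le_trans (step k) _; rewrite good.
have inv d : S (len (K + d)) <= S (len K) + Phi (v K) - Phi (v (K + d)).
  elim: d => [|d IH]; first by rewrite addn0; lra.
  have := HK (K + d)%N (leq_addr _ _); have := step (K + d)%N.
  rewrite addnS psum_lenS; case ok: (o (K + d)%N).1 => [j|] // + _.
  by rewrite (wsum_dev_pre ok); lra.
apply/mp_leP => eps e0.
exists (S (len K) + Phi (v K) + \sum_x `|Phi x|) => N.
exists (len (K + N)); first by rewrite (leq_trans _ (leq_len _)) // leq_addl.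
have := inv N; have := potential_bound Phi (v (K + N)); rewrite ler_norml.
have : 0 <= eps * (len (K + N))%:R by rewrite mulr_ge0 // ltW.
lra.
Qed.

End DeviationSequences.

(** * Plays of the reduced game and their payoffs *)

Section Plays.
Variables (R : realType) (Pl V : finType) (E : rel V) (owner : V -> Pl).
Variables (r : Pl -> V -> V -> rat) (lam : V -> \bar R) (i : Pl) (beta : nat).
Variables (v0 : V) (sel : pun_family Pl V -> V -> seq V).

Local Notation rtrans := (rtrans E owner r lam i beta).
Local Notation tpath := (tpath E owner r lam i beta).
Local Notation valid_strategy := (valid_strategy E owner r lam i beta v0).
Local Notation valid_family := (valid_family E owner r lam beta).
Local Notation proposes := (@proposes R Pl V E owner r lam i beta).
Local Notation SProver := (SProver Pl).
Local Notation STop := (STop Pl V).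
Local Notation SBot := (SBot Pl V).
Local Notation nuC := (nuC R E r i v0 sel).
Local Notation dot := (dot R E r v0 sel).
Local Notation rep := (rep R E r v0).

Lemma tpath_rcons x t y :
  tpath x (rcons t y) <-> tpath x t /\ rtrans (last x t) y.
Proof.
elim: t x => [|z t IH] x /=; first by tauto.
by have := IH z; tauto.
Qed.

Section Outcome.
Variables sP sC : strategy Pl V.
Hypotheses (valP : valid_strategy true sP) (valC : valid_strategy false sC).
Local Notation pi := (outcome v0 sP sC).

Lemma outcomeS k : pi k.+1 =
  if isProver (pi k) then sP (out_tail v0 sP sC k) else sC (out_tail v0 sP sC k).
Proof. by rewrite /outcome /= last_rcons. Qed.

Lemma tpath_out_tail k : tpath (SProver v0) (out_tail v0 sP sC k).
Proof.
elim: k => //= k IH; rewrite tpath_rcons; split=> //.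
by case: ifP => p; [apply: valP|apply: valC].
Qed.

Lemma outcome_trans k : rtrans (pi k) (pi k.+1).
Proof. by have := tpath_out_tail k.+1; rewrite /= tpath_rcons {2}/outcome /= last_rcons => -[]. Qed.

End Outcome.

Section Play.
Variable pi : nat -> rstate Pl V.
Hypotheses (pi0 : pi 0%N = SProver v0) (trans : forall k, rtrans (pi k) (pi k.+1)).

Lemma bot_absorbing k m : pi k = SBot -> pi (k + m)%N = SBot.
Proof.
move=> pk; elim: m => [|m IH]; first by rewrite addn0.
by have := trans (k + m); rewrite IH addnS /=; case: (pi _).
Qed.

Lemma top_absorbing k m : pi k = STop -> pi (k + m)%N = STop.
Proof.
move=> pk; elim: m => [|m IH]; first by rewrite addn0.
by have := trans (k + m); rewrite IH addnS /=; case: (pi _).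
Qed.

Lemma family_valid k f : pi k = SFam f -> valid_family f.
Proof.
case: k => [|k] pk; first by move: pk; rewrite pi0.
by have := trans k; rewrite pk; case: (pi k) => //= v [].
Qed.

Lemma top_no_bot k j : pi k = STop -> pi j <> SBot.
Proof.
move=> pk pj; have := top_absorbing j pk; have := bot_absorbing k pj.
by rewrite addnC => ->.
Qed.

Lemma rep_payoff f : valid_family f -> mp R r i (rep f) = (ratr (fx f i))%:E.
Proof.
case=> _ _ [p [n [_ [rho' [pE [play [pay occ]]]]]]] _ _.
suff : isPlay E (rep f) /\ has_payoff R r (rep f) (fx f) /\ occ_is (rep f) (fW f).
  by move=> [_ [/(_ i)]].
apply: (epsilon_spec (inhabits (fun=> v0))
  (fun rho => isPlay E rho /\ has_payoff R r rho (fx f) /\ occ_is rho (fW f))).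
(* The tail of any member of the family meets the description of [rep]; it is a play as a suffix of
   one. *)
exists rho'; split=> // k.
by have := play (size (fh f ++ ncat n (fc f)) + k)%N; rewrite pE -addnS !catstream_shift.
Qed.

(** [dot] is chosen by description, so a witness is needed: a play enters [STop] at most once, hence
    only one equation is demanded of it. *)
Lemma dot_top k f : pi k = SFam f -> pi k.+1 = STop ->
  dot pi = catstream (acc sel pi k.+1) (rep f).
Proof.
move=> pk pk1; suff [H _] : is_dot R E r v0 sel pi (dot pi) by exact: H.
apply: (epsilon_spec (inhabits (fun=> v0)) (is_dot R E r v0 sel pi)).
exists (catstream (acc sel pi k.+1) (rep f)); split; last by move=> /(_ k.+1).
move=> k' f' pk' pk1'.
have kk' : k' = k.
  have [lt|lt|//] := ltngtP k' k.
    by have := top_absorbing (k - k'.+1) pk1'; rewrite subnKC // pk.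
  by have := top_absorbing (k' - k.+1) pk1; rewrite subnKC // pk'.
by move: pk' pk1'; rewrite kk' pk => -[->].
Qed.

Lemma acc_nth k d n : (n < size (acc sel pi k))%N ->
  nth v0 (acc sel pi (k + d)) n = nth v0 (acc sel pi k) n /\
  (n < size (acc sel pi (k + d)))%N.
Proof.
move=> nk; elim: d => [|d [IH1 IH2]]; first by rewrite addn0.
by rewrite addnS /= nth_cat IH2 IH1 size_cat ltn_addr.
Qed.

Lemma dot_no_top : (forall k, pi k <> STop) ->
  forall k n, (n < size (acc sel pi k))%N -> dot pi n = nth v0 (acc sel pi k) n.
Proof.
move=> ntop; suff [_ H] : is_dot R E r v0 sel pi (dot pi) by exact: H.
apply: (epsilon_spec (inhabits (fun=> v0)) (is_dot R E r v0 sel pi)).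
(* The accumulated histories extend one another, so all that reach position [n] agree there. *)
have /choice[rho rhoP] : forall n, exists x, forall k,
    (n < size (acc sel pi k))%N -> x = nth v0 (acc sel pi k) n.
  move=> n; have [[k nk]|no] := pselect (exists k, (n < size (acc sel pi k))%N).
    exists (nth v0 (acc sel pi k) n) => k' nk'.
    have [<- _] := acc_nth k' nk; have [<- _] := acc_nth k nk'.
    by rewrite addnC.
  by exists v0 => k nk; case: no; exists k.
by exists rho; split=> [k f _ /ntop|_ k n nk] //; apply: rhoP.
Qed.

(** Every round ending in a deviation takes three moves, hence the multiples of 3. *)
Definition dev_play (v : nat -> V) (a : nat -> fam_code Pl V beta)
    (o : nat -> dev_code V) :=
  forall k, [/\ pi (k * 3) = SProver (v k), pi (k * 3).+1 = SFam (fam_dec (a k)),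
    pi (k * 3).+2 = dev_dec (a k) (o k) & (o k).2 = v k.+1].

Lemma play_cases :
  [\/ exists k, pi k = SBot,
      exists k f, pi k = SFam f /\ pi k.+1 = STop |
      exists v a o, dev_play v a o].
Proof.
have [hb|nb] := pselect (exists k, pi k = SBot); first by constructor 1.
have [ht|nt] := pselect (exists k f, pi k = SFam f /\ pi k.+1 = STop).
  by constructor 2.
constructor 3.
have step k v : pi k = SProver v -> exists ao : fam_code Pl V beta * dev_code V,
    [/\ pi k.+1 = SFam (fam_dec ao.1), pi k.+2 = dev_dec ao.1 ao.2 &
        pi k.+3 = SProver ao.2.2].
  move=> pk; have [f [pf valf]] : exists f, pi k.+1 = SFam f /\ valid_family f.
    have := trans k; rewrite pk; case pk1: (pi k.+1) => [|f||||] //=.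
      by move=> [vf _]; exists f.
    by case: nb; exists k.+1.
  have [a fa] := fam_dec_onto valf.
  rewrite {}fa in pf; have := trans k.+1; rewrite pf => /dev_dec_onto[top|[o po]].
    by case: nt; exists k.+1, (fam_dec a).
  exists (a, o); split=> //.
  have := trans k.+2; rewrite po /dev_dec.
  by case: o.1 => [j|] /=; case: (pi k.+3) => //= u ->.
have /choice[v vP] : forall k, exists v, pi (k * 3)%N = SProver v.
  elim=> [|k [v pk]]; first by exists v0.
  by have [ao [_ _ ?]] := step _ _ pk; exists ao.2.2.
have /choice[ao aoP] := fun k => step _ _ (vP k).
exists v, (fun k => (ao k).1), (fun k => (ao k).2) => k.
have [p1 p2 p3] := aoP k; split=> //.
by have := vP k.+1; rewrite (_ : (k.+1 * 3 = (k * 3).+3)%N) // p3 => -[].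
Qed.

Lemma nuC_bot : (exists k, pi k = SBot) -> nuC pi = +oo%E.
Proof. by rewrite /nuC => H; rewrite asboolT. Qed.

Lemma nuC_top_ge alpha k f : pi k = SFam f -> pi k.+1 = STop ->
  alpha <= ratr (fx f i) -> (alpha%:E <= nuC pi)%E.
Proof.
move=> pk pk1 le; rewrite /nuC asboolF; last by move=> [j]; exact: top_no_bot pk1.
rewrite (dot_top pk pk1); apply: mp_catstream_ge.
by rewrite rep_payoff ?lee_fin //; apply: family_valid pk.
Qed.

Lemma nuC_top_le alpha k f : pi k = SFam f -> pi k.+1 = STop ->
  ratr (fx f i) <= alpha -> (nuC pi <= alpha%:E)%E.
Proof.
move=> pk pk1 le; rewrite /nuC asboolF; last by move=> [j]; exact: top_no_bot pk1.
rewrite (dot_top pk pk1); apply: mp_catstream_le.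
by rewrite rep_payoff ?lee_fin //; apply: family_valid pk.
Qed.

Section DevPlay.
Variables (v : nat -> V) (a : nat -> fam_code Pl V beta) (o : nat -> dev_code V).
Hypothesis vao : dev_play v a o.

Lemma dev_play_proposes k : proposes (v k) (a k).
Proof. by have [p1 p2 _ _] := vao k; have := trans (k * 3)%N; rewrite p1 p2. Qed.

Lemma dev_play_state k : pi k <> STop /\ pi k <> SBot.
Proof.
have : (k < k.+1 * 3)%N by lia.
move=> /ltnW /subnK; have [+ _ _ _] := vao k.+1; set d := (_ - _)%N => pk dk.
split=> pk0.
  by have := top_absorbing d pk0; rewrite addnC dk pk.
by have := bot_absorbing d pk0; rewrite addnC dk pk.
Qed.

Lemma acc_dev_play k : acc sel pi (k * 3) = dev_hist_seq sel a o k.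
Proof.
elim: k => // k IH.
rewrite (_ : (k.+1 * 3 = (k * 3).+3)%N) //=; have [p0 p1 p2 _] := vao k.
have [p3 _ _ _] := vao k.+1; rewrite (_ : (k.+1 * 3 = (k * 3).+3)%N) // in p3.
rewrite IH p0 p1 p2 p3 /= cats0.
by rewrite /dev_dec; case: (o k).1 => [j|] /=; rewrite cats0.
Qed.

Lemma nuC_dev_play : nuC pi = mp R r i (dot pi).
Proof. by rewrite /nuC asboolF // => -[k]; have [] := dev_play_state k. Qed.

Lemma dot_dev_play k n : (n < size (dev_hist_seq sel a o k))%N ->
  dot pi n = nth v0 (dev_hist_seq sel a o k) n.
Proof.
rewrite -acc_dev_play; apply: dot_no_top => j; by have [] := dev_play_state j.
Qed.

Lemma nuC_dev_play_ge alpha Phi :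
  (forall k, Phi (v k.+1) <= Phi (v k) + dev_weight r i alpha (a k) (o k)) ->
  (alpha%:E <= nuC pi)%E.
Proof.
rewrite nuC_dev_play; apply: (dev_seq_mp_ge dev_play_proposes _ dot_dev_play).
by move=> k; have [] := vao k.
Qed.

Lemma nuC_dev_play_le alpha Phi :
  (forall k, Phi (v k.+1) <= Phi (v k) - dev_weight r i alpha (a k) (o k)) ->
  (nuC pi <= alpha%:E)%E.
Proof.
rewrite nuC_dev_play; apply: (dev_seq_mp_le dev_play_proposes _ dot_dev_play).
by move=> k; have [] := vao k.
Qed.

End DevPlay.
End Play.

(** * From certificates to strategies, and optimality *)

Local Notation prover_value := (prover_value E owner r lam i beta v0 sel).

Lemma challenger_cert_value alpha (U : {set V}) Phi sP :
  valid_strategy true sP -> v0 \in U ->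
  @challenger_cert R Pl V E owner r lam i beta alpha U Phi ->
  (alpha%:E <= prover_value sP)%E.
Proof.
move=> valP v0U cert.
(* A family starts at the vertex that proposes it, so [f] determines [u] and Challenger's reply may
   depend on [f] alone. *)
have /choice[g gP] : forall f, exists s, rtrans (SFam f) s /\
    forall u, u \in U -> rtrans (SProver u) (SFam f) ->
      (s = STop /\ alpha <= ratr (fx f i)) \/
      exists a o, [/\ f = fam_dec a, s = dev_dec a o, o.2 \in U &
                   Phi o.2 <= Phi u + dev_weight r i alpha (a : fam_code Pl V beta) o].
  move=> f.
  have [[u uU prop]|no] := pselect (exists2 u, u \in U & rtrans (SProver u) (SFam f)).
    have uniq u' : rtrans (SProver u') (SFam f) -> u' = u.
      by move: prop => [_ [+ +]] [_ [+ _]]; case: (fh f) => //= x l -> _ ->.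
    have [a fa] : exists a, f = fam_dec (a : fam_code Pl V beta).
      by case: prop => /fam_dec_onto.
    have [|le|[o dev [oU le]]] := cert u a uU; first by rewrite fa in prop.
      exists STop; split=> // u' _ _; left; split=> //; by rewrite fa.
    exists (dev_dec a o); split; first by rewrite fa.
    by move=> u' _ /uniq ->; right; exists a, o.
  by exists STop; split=> // u uU prop; case: no; exists u.
pose sC : strategy Pl V := fun t => match last (SProver v0) t with
  | SFam f => g f | SPre _ u => SProver u | SPost _ u => SProver u
  | Defs.STop => STop | Defs.SBot => SBot | Defs.SProver _ => STop end.
have valC : valid_strategy false sC.
  move=> t _; rewrite /sC; case: (last _ t) => //= f _.
  exact: (gP f).1.
apply: le_trans (ereal_sup_ubound _); last by exists sC.
set pi := outcome v0 sP sC.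
have trans := outcome_trans valP valC.
have piC k f : pi k = SFam f -> pi k.+1 = g f.
  by rewrite /pi outcomeS /sC => pk; rewrite pk /=; move: pk; rewrite /outcome => ->.
have pi0 : pi 0%N = SProver v0 by [].
(* The play stays in [U]; at a family state the invariant records the proposing vertex, where the
   certificate applies. *)
have inU k : match pi k return Prop with
    | Defs.SProver u | SPre _ u | SPost _ u => u \in U
    | SFam f => exists2 u, u \in U & rtrans (SProver u) (SFam f)
    | _ => True end.
  elim: k => [|k IH]; first by rewrite pi0.
  have := trans k; rewrite -/pi; case pk: (pi k) IH => [u|f|l u|l u||] IH.
  - by case pk1: (pi k.+1) => [|f||||] //= tr; exists u.
  - rewrite (piC _ _ pk) => _; have [u uU /((gP f).2 u uU)] := IH.
    move=> [[-> //]|[a [o [_ -> oU _]]]].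
    by rewrite /dev_dec; case: o.1.
  - by case: (pi k.+1) => //= u' ->.
  - by case: (pi k.+1) => //= u' ->.
  - by case: (pi k.+1).
  - by case: (pi k.+1).
have [hb|[k [f [pk pk1]]]|[v [a [o vao]]]] := play_cases pi0 trans.
- by rewrite nuC_bot // leey.
- apply: (nuC_top_ge pi0 trans pk pk1).
  have := inU k; rewrite pk => -[u uU /((gP f).2 u uU)] [[]//|[a [o [_]]]].
  by rewrite -(piC _ _ pk) pk1 /dev_dec; case: o.1.
- apply: (nuC_dev_play_ge trans vao (Phi := Phi)) => k.
  have [p0 p1 p2 ov] := vao k.
  have vU : v k \in U by have := inU (k * 3)%N; rewrite p0.
  have [[gt _]|[a' [o' [fE gE _ le]]]] :=
    (gP _).2 (v k) vU (dev_play_proposes trans vao k).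
    by move: p2; rewrite (piC _ _ p1) gt /dev_dec; case: (o k).1.
  (* The codes given by [play_cases] may differ from those of the certificate; the decoded states
     agree. *)
  have dE : dev_dec (a k) (o k) = dev_dec a' o' by rewrite -p2 (piC _ _ p1).
  have oE : (o k).2 = o'.2.
    by move: dE; rewrite /dev_dec; case: (o k).1 => [?|]; case: o'.1 => [?|] // [].
  by rewrite (dev_weight_dec _ _ _ fE dE) -ov oE.
Qed.

(** [None] means giving up, which is always legal. At Challenger's states [STop] is a default
    value. *)
Definition positional (sg : V -> option (fam_code Pl V beta)) : strategy Pl V :=
  fun t => match last (SProver v0) t with
    | Defs.SProver u => if sg u is Some a then SFam (fam_dec a) else SBot
    | _ => STop
    end.

Definition valid_positional (sg : V -> option (fam_code Pl V beta)) :=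
  forall u a, sg u = Some a -> proposes u a.

Lemma positional_valid sg : valid_positional sg -> valid_strategy true (positional sg).
Proof.
move=> vsg t _; rewrite /positional; case: (last _ t) => //= u _.
by case sgu: (sg u) => [a|] //; apply: vsg.
Qed.

Lemma positional_memoryless sg :
  memoryless E owner r lam i beta v0 (positional sg).
Proof. by move=> t t' _ _ _ eq_last; rewrite /positional eq_last. Qed.

Lemma prover_cert_value alpha (U : {set V}) Phi sg :
  valid_positional sg -> v0 \in U ->
  @prover_cert R Pl V E owner r lam i beta alpha U Phi sg ->
  (prover_value (positional sg) <= alpha%:E)%E.
Proof.
move=> vsg v0U cert; apply: ge_ereal_sup => _ [sC valC <-].
have trans := outcome_trans (positional_valid vsg) valC.
set pi := outcome v0 _ sC in trans *.
have pi0 : pi 0%N = SProver v0 by [].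
have piP k u : pi k = SProver u ->
    pi k.+1 = if sg u is Some a then SFam (fam_dec a) else SBot.
  rewrite /pi outcomeS => pk; rewrite pk /= /positional.
  by move: pk; rewrite /outcome => ->.
have inU k : match pi k return Prop with
    | Defs.SProver u | SPre _ u | SPost _ u => u \in U
    | SFam f => exists2 u, u \in U & exists2 a, sg u = Some a & f = fam_dec a
    | Defs.SBot => False | Defs.STop => True end.
  elim: k => [|k IH]; first by rewrite pi0.
  have := trans k; case pk: (pi k) IH => [u|f|l u|l u||] IH.
  - rewrite (piP _ _ pk) => _; have [a [sgu _ _ _]] := cert u IH.
    by rewrite sgu; exists u => //; exists a.
  - have [u uU [a sgu ->]] := IH; have [a' [+ _ _ dev]] := cert u uU.
    rewrite sgu => -[aa']; rewrite -{}aa' in dev => tr.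
    have [-> //|[o so]] := dev_dec_onto tr; rewrite so in tr *.
    by have [oU _] := dev o tr; rewrite /dev_dec; case: o.1.
  - by case: (pi k.+1) => //= u' ->.
  - by case: (pi k.+1) => //= u' ->.
  - by case: (pi k.+1).
  - by case: (pi k.+1).
have [[k pk]|[k [f [pk pk1]]]|[v [a [o vao]]]] := play_cases pi0 trans.
- by have := inU k; rewrite pk.
- apply: (nuC_top_le pi0 trans pk pk1).
  have := inU k; rewrite pk => -[u uU [a sgu ->]].
  by have [a' [+ _ /ltW + _]] := cert u uU; rewrite sgu => -[->].
- apply: (nuC_dev_play_le trans vao (Phi := Phi)) => k.
  have [p0 p1 p2 ov] := vao k.
  have vU : v k \in U by have := inU (k * 3)%N; rewrite p0.
  have [a' [sgv _ _ dev]] := cert _ vU.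
  have fE : fam_dec (a k) = fam_dec a'.
    by move: p1; rewrite (piP _ _ p0) sgv; congruence.
  have dE : dev_dec (a k) (o k) = dev_dec a' (o k) by rewrite /dev_dec fE.
  have [|_ le] := dev (o k).
    by have := outcome_trans (positional_valid vsg) valC (k * 3).+1;
      rewrite -/pi p1 p2 dE fE.
  by rewrite (dev_weight_dec _ _ _ fE dE) -ov.
Qed.

Lemma threshold_dichotomy (alpha : R) :
  (forall sP, valid_strategy true sP -> (alpha%:E <= prover_value sP)%E) \/
  exists2 sg : {ffun V -> option (fam_code Pl V beta)}, valid_positional sg &
    (prover_value (positional sg) <= alpha%:E)%E.
Proof.
have [[U v0U [Phi cert]]|[U v0U [Phi [sg cert]]]] :=
  arena_dichotomy E owner r lam i beta alpha v0; [left|right].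
  by move=> sP valP; apply: challenger_cert_value cert.
(* Outside [U] the certificate does not make [sg] legal, so Prover gives up there. *)
pose sg' := [ffun u => if u \in U then sg u else None].
have vsg : valid_positional sg'.
  move=> u a; rewrite ffunE; case: ifP => // uU; have [a' [-> ? _ _]] := cert u uU.
  by move=> [<-].
exists sg' => //; apply: (prover_cert_value (U := U) (Phi := Phi)) => // u uU.
by rewrite ffunE uU; apply: cert.
Qed.

Lemma positional_optimal : exists sP : strategy Pl V,
  [/\ valid_strategy true sP, memoryless E owner r lam i beta v0 sP &
      optimal_prover E owner r lam i beta v0 sel sP].
Proof.
pose val (sg : {ffun V -> option (fam_code Pl V beta)}) := prover_value (positional sg).
pose bot : {ffun V -> option (fam_code Pl V beta)} := [ffun=> None].
(* Giving up everywhere shows that the set to minimise over is inhabited. *)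
have vbot : `[< valid_positional bot >] by apply/asboolP => u a; rewrite ffunE.
have [sg /asboolP vsg sgmin] := @arg_minP _ _ _ bot
  (fun sg => `[< valid_positional sg >]) val vbot.
exists (positional sg); split;
  [exact: positional_valid | exact: positional_memoryless |].
apply/eqP; rewrite eq_le; apply/andP; split; last first.
  by apply: ereal_inf_lbound; exists (positional sg) => //; apply: positional_valid.
apply: le_ereal_inf_tmp => _ [sP valP <-]; rewrite leNgt; apply/negP => lt.
(* A strategy beating the best positional one leaves a real number strictly between the two values;
   at this threshold both alternatives of the dichotomy fail. *)
have [alpha lt1 lt2] : exists2 alpha : R, (prover_value sP < alpha%:E)%E &
    (alpha%:E < prover_value (positional sg))%E.
  move: lt; case: (prover_value sP) => [x| |]; case: prover_value => [y| |] //.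
  - rewrite lte_fin => xy; exists ((x + y) / 2); rewrite lte_fin; lra.
  - by move=> _; exists (x + 1); rewrite ?ltry // lte_fin; lra.
  - by move=> _; exists (y - 1); rewrite ?ltNyr // lte_fin; lra.
  - by move=> _; exists 0; rewrite ?ltry ?ltNyr.
have [ge|[sg' vsg' le]] := threshold_dichotomy alpha.
  by have := lt_le_trans lt1 (ge _ valP); rewrite ltxx.
have min := sgmin sg' (asboolT vsg').
by have := lt_le_trans lt2 (le_trans min le); rewrite ltxx.
Qed.

End Plays.

Theorem lemma7 (R : realType) (Pl V : finType) (E : rel V)
  (owner : V -> Pl) (r : Pl -> V -> V -> rat)
  (HE : forall v, exists w, E v w)
  (lam : V -> \bar R) (i : Pl) (v0 : V) (Hv0 : owner v0 = i) (beta : nat)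
  (sel : pun_family Pl V -> V -> seq V) (Hsel : shortest_sel E owner i sel) :
  exists sP : strategy Pl V,
    [/\ valid_strategy E owner r lam i beta v0 true sP,
        memoryless E owner r lam i beta v0 sP &
        optimal_prover E owner r lam i beta v0 sel sP].
Proof. exact: positional_optimal. Qed.
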